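(* The Hopf algebra $H_{\operatorname{NAP}}$ is isomorphic to the Connes–Kreimer Hopf algebra $\mathcal{H}_R$ of rooted trees; an isomorphism (the unique one compatible with the cocycles $L_{\operatorname{NAP}}$ on $H_{\operatorname{NAP}}$, $L_{\operatorname{NAP}}(\mathsf{F}_{[t]})=\mathsf{F}_{[B(r,t)]}$, and $B^+$ on $\mathcal{H}_R$) sends $\mathsf{F}_{[B(r,t_1,\dots,t_k)]}$ to the forest $t_1\cdots t_k$ for all unlabeled rooted trees $t_1,\dots,t_k$, $k\geq0$ (the empty forest being $1$).
   Context: $B(r,t_1,\dots,t_k)$ is the rooted tree obtained by adding a new root $r$ joined to the roots of $t_1,\dots,t_k$. $\Pi_{\operatorname{NAP}}(I)$ is the set of forests of rooted trees with vertex set exactly $I$, ordered by: $y$ covers $x$ iff $y$ is obtained from $x$ by adding an edge from the root of one component of $x$ to the root of another component (the latter root remaining the root); $\widehat{0}$ is the forest of one-vertex trees. $H_{\operatorname{NAP}}$ is Schmitt's incidence Hopf algebra of the intervals $[\widehat{0},t]$, $t$ rooted trees: basis $\mathsf{F}_{[Q]}$ indexed by isomorphism classes of finite products $Q$ of such intervals, product from direct product, coproduct $\Delta\mathsf{F}_{[Q]}=\sum_{x\in Q}\mathsf{F}_{[\widehat{0},x]}\otimes\mathsf{F}_{[x,\widehat{1}]}$; $\mathsf{F}_{[t]}$ denotes the basis element of the class of $[\widehat{0},t]$ (these form a basis as $t$ runs over unlabeled rooted trees, so $L_{\operatorname{NAP}}$ is well defined linearly). The Connes–Kreimer Hopf algebra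 $\mathcal{H}_R$ is the free commutative algebra on unlabeled rooted trees (monomials are forests), with the linear map $B^+(t_1\cdots t_k)=B(r,t_1,\dots,t_k)$ ($B^+(1)$ the one-vertex tree), and coproduct determined by $\Delta(1)=1\otimes1$, multiplicativity and $\Delta(B^+(x))=B^+(x)\otimes1+(\mathrm{id}\otimes B^+)(\Delta(x))$ for forests $x$. *)

(* Defs.v *)
From HB Require Import structures.
From mathcomp Require Import all_boot all_order all_algebra.
From mathcomp Require Import finmap.
From mathcomp Require Import monalg.

Set Implicit Arguments.
Unset Strict Implicit.
Unset Printing Implicit Defensive.

Import GRing.Theory.
Local Open Scope ring_scope.

(* A finite poset on {0,..,n-1}, given by its (reflexive) order relation. *)
Definition fposet : Type := {n : nat & {ffun 'I_n * 'I_n -> bool}}.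

Definition mkfp (n : nat) (r : {ffun 'I_n * 'I_n -> bool}) : fposet :=
  Tagged (fun n => {ffun 'I_n * 'I_n -> bool}) r.

Definition fp_of (T : finType) (A : {set T}) (r : rel T) : fposet :=
  @mkfp #|A| [ffun ij : 'I_#|A| * 'I_#|A| =>
                r (enum_val ij.1) (enum_val ij.2)].

Definition fp_iso (P Q : fposet) : bool :=
  (tag P == tag Q) &&
  [exists f : {ffun 'I_(tag P) -> 'I_(tag Q)},
     injectiveb f &&
     [forall i, forall j, tagged P (i, j) == tagged Q (f i, f j)]].

Definition fp_canon (P : fposet) : fposet :=
  @mkfp (tag P) [arg min_(r < tagged P | fp_iso P (mkfp r)) enum_rank r].

Definition fp_prod (P Q : fposet) : fposet :=
  @fp_of ('I_(tag P) * 'I_(tag Q))%type setT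
    (fun x y => tagged P (x.1, y.1) && tagged Q (x.2, y.2)).

Definition fp_pt : fposet := @mkfp 1 [ffun _ => true].

(* Intervals [0^, a] and [a, 1^] of a (bounded) finite poset. *)
Definition fp_down (P : fposet) (a : 'I_(tag P)) : fposet :=
  @fp_of 'I_(tag P) [set b | tagged P (b, a)] (fun b c => tagged P (b, c)).
Definition fp_up (P : fposet) (a : 'I_(tag P)) : fposet :=
  @fp_of 'I_(tag P) [set b | tagged P (a, b)] (fun b c => tagged P (b, c)).

(* A rooted forest on 'I_n: each vertex points to its parent (None = root),
   and following parents always terminates. *)
Definition acyclic n (p : {ffun 'I_n -> option 'I_n}) : bool :=
  [forall i, iter n (fun o => obind (fun j => p j) o) (Some i) == None].

Definition is_rtree n (p : {ffun 'I_n -> option 'I_n}) : bool :=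
  acyclic p && (#|[set i | p i == None]| == 1%N).

(* y covers x : add an edge from the root a of one component to the root b
   of another one, b remaining the root (so a becomes a child of b). *)
Definition nap_cover n (x y : {ffun 'I_n -> option 'I_n}) : bool :=
  [exists a, exists b, [&& a != b, x a == None, x b == None &
     y == [ffun i => if i == a then Some b else x i]]].

Definition nap_le n : rel {ffun 'I_n -> option 'I_n} := connect (@nap_cover n).

Definition nap_zero n : {ffun 'I_n -> option 'I_n} := [ffun => None].

Definition nap_int n (t : {ffun 'I_n -> option 'I_n}) : fposet :=
  @fp_of {ffun 'I_n -> option 'I_n}
    [set x | nap_le (nap_zero n) x && nap_le x t] (@nap_le n).

Definition lforest : Type := {n : nat & {ffun 'I_n -> option 'I_n}}.

Definition nap_poset (Q : fposet) : Prop :=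
  exists ts : seq lforest,
    all (fun s : lforest => is_rtree (tagged s)) ts /\
    fp_iso Q (foldr fp_prod fp_pt [seq nap_int (tagged s) | s <- ts]).

(* Raw (plane) trees: GenTree.Node _ children.  Unlabeled rooted trees are
   represented by canonical raw trees: every node labelled 0, no leaves, and
   children sorted by the (injective) pickle order, recursively. *)
Definition rawtree := GenTree.tree nat.

Definition tle (a b : rawtree) : bool := leq (choice.pickle a) (choice.pickle b).

Fixpoint canon_tree (t : rawtree) : bool :=
  match t with
  | GenTree.Leaf _ => false
  | GenTree.Node n ts => (n == 0)%N && sorted tle ts && all canon_tree ts
  end.

Definition utree := {t : rawtree | canon_tree t}.

Definition u1 : utree := exist canon_tree (GenTree.Node 0 [::]) (erefl true).

(* The forest t1 ... tk coded by a monomial, as a list with multiplicities. *)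
Definition mlist (m : {cmonom utree}) : seq utree :=
  flatten [seq nseq (m u) u | u <- finsupp m].

Lemma tle_total : total tle.
Proof. by move=> a b; exact: leq_total. Qed.

Lemma canon_Bplus (s : seq utree) :
  canon_tree (GenTree.Node 0 (sort tle [seq val u | u <- s])).
Proof.
rewrite /= sort_sorted ?all_sort; last exact: tle_total.
by apply/allP => x /mapP [u _ ->]; exact: valP.
Qed.

Definition Bnode (s : seq utree) : utree :=
  exist canon_tree _ (canon_Bplus s).

Definition Bplus_m (m : {cmonom utree}) : utree := Bnode (mlist m).

(* A labelled realization of a raw tree on 'I_n: parent list (root 0). *)
Fixpoint attach (off : nat) (ls : seq (seq (option nat))) : seq (option nat) :=
  match ls with
  | [::] => [::]
  | l :: ls' =>
      [seq (if o is Some j then Some (j + off)%N else Some 0%N) | o <- l]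
        ++ attach (off + size l) ls'
  end.

Fixpoint lab (t : rawtree) : seq (option nat) :=
  match t with
  | GenTree.Leaf _ => [:: None]
  | GenTree.Node _ ts => None :: attach 1 (map lab ts)
  end.

Definition lab_ffun (l : seq (option nat)) : {ffun 'I_(size l) -> option 'I_(size l)} :=
  [ffun i : 'I_(size l) => obind (fun j => insub j) (nth None l i)].

Definition tree_int (t : rawtree) : fposet := nap_int (lab_ffun (lab t)).

(* 4. H_NAP (inside the free module on all finite posets)                  *)

Section HNAP.
Variable R : comRingType.

Definition MN := {malg R[fposet]}.
Definition TN := {malg R[(fposet * fposet)%type]}.

Definition FN (Q : fposet) : MN := << fp_canon Q >>.

Definition in_HNAP (x : MN) : Prop :=
  forall P, P \in msupp x -> exists Q, nap_poset Q /\ P = fp_canon Q.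

Definition mulN (x y : MN) : MN :=
  \sum_(p <- msupp x) \sum_(q <- msupp y)
     (x@_p * y@_q) *: FN (fp_prod p q).

Definition oneN : MN := FN fp_pt.

Definition epsN (x : MN) : R :=
  \sum_(p <- msupp x) (if tag p == 1%N then x@_p else 0).

Definition DeltaN_b (P : fposet) : TN :=
  \sum_(a : 'I_(tag P)) << (fp_canon (fp_down a), fp_canon (fp_up a)) >>.

Definition DeltaN (x : MN) : TN := \sum_(p <- msupp x) x@_p *: DeltaN_b p.

(* the cocycle L_NAP on the basis: F_[t] |-> F_[B(r,t)] *)
Definition LN (t : utree) : MN := FN (tree_int (GenTree.Node 0 [:: val t])).

(* free commutative algebra on unlabeled rooted trees; monomials = forests *)
Definition HR := {malg R[{cmonom utree}]}.
Definition TR := {malg R[({cmonom utree} * {cmonom utree})%type]}.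

Definition tree (t : utree) : HR := << ucm t >>.

Definition tone : TR := << (onecm utree, onecm utree) >>.

Definition tmul (x y : TR) : TR :=
  \sum_(p <- msupp x) \sum_(q <- msupp y)
    (x@_p * y@_q) *: << (mulcm p.1 q.1, mulcm p.2 q.2) >>.

Definition Bp (x : HR) : HR := \sum_(m <- msupp x) x@_m *: tree (Bplus_m m).

Definition idBp (x : TR) : TR :=
  \sum_(p <- msupp x) x@_p *: << (p.1, ucm (Bplus_m p.2)) >>.

(* Delta on a tree B^+(x): B^+(x) (x) 1 + (id (x) B^+)(Delta x), with
   Delta multiplicative on the forest x of the children. *)
Fixpoint DeltaT (t : rawtree) : TR :=
  match t with
  | GenTree.Leaf _ => 0
  | GenTree.Node _ ts =>
      << (ucm (Bnode (map (insubd u1) ts)), onecm utree) >>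
      + idBp (foldr tmul tone (map DeltaT ts))
  end.

Definition DeltaF (m : {cmonom utree}) : TR :=
  foldr tmul tone [seq DeltaT (val u) | u <- mlist m].

Definition DeltaR (x : HR) : TR := \sum_(m <- msupp x) x@_m *: DeltaF m.

Definition epsR (x : HR) : R := x@_(onecm utree).

Definition tpure (a b : HR) : TR :=
  \sum_(m1 <- msupp a) \sum_(m2 <- msupp b) (a@_m1 * b@_m2) *: << (m1, m2) >>.

Definition tens (phi : MN -> HR) (w : TN) : TR :=
  \sum_(p <- msupp w) w@_p *: tpure (phi << p.1 >>) (phi << p.2 >>).

Definition hopf_iso_NAP_R (phi : MN -> HR) : Prop :=
  [/\ forall (a : R) (x y : MN), phi (a *: x + y) = a *: phi x + phi y,
      (forall x y, in_HNAP x -> in_HNAP y -> phi x = phi y -> x = y),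
      (forall z : HR, exists2 x, in_HNAP x & phi x = z),
      phi oneN = 1 /\
      (forall x y, in_HNAP x -> in_HNAP y -> phi (mulN x y) = phi x * phi y) &
      (forall x, in_HNAP x ->
          epsR (phi x) = epsN x /\ tens phi (DeltaN x) = DeltaR (phi x))].

End HNAP.

(* Main.v *)
(** A forest [x] lies below [p] in the NAP order iff its edges are edges of [p]
    and its set of non-root vertices is closed under descendants in [p]. Hence
    [[0, p]] is the lattice [J(P)] of down-sets of the poset [P] of non-root
    vertices of [p], ordered by ancestry with ancestors on top; for
    [p = B(r, t1, ..., tk)] the poset [P] is the forest [t1 ... tk]. By Birkhoff's
    theorem [P] is recovered as the poset of join-irreducible elements, so
    [F_[J(P)] |-> P] is a well-defined bijection from the basis of [H_NAP] to the
    forests. It is multiplicative since [J(P) x J(Q) = J(P + Q)]. In [J(P)] the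
    interval below [D] is [J(D)] and the interval above it is [J(P \ D)], so the
    coproduct is the sum over down-sets [D] of [D (x) P \ D], that is, over
    admissible cuts, and this sum satisfies the recursion defining the
    Connes-Kreimer coproduct. Uniqueness is an induction on trees:
    multiplicativity reduces a forest to trees, and the cocycle condition reduces
    a tree [B^+(x)] to the forest [x]. *)

Require Import Defs.
From HB Require Import structures.
From mathcomp Require Import all_boot all_order all_algebra.
From mathcomp Require Import finmap.
From mathcomp Require Import monalg.

Set Implicit Arguments.
Unset Strict Implicit.
Unset Printing Implicit Defensive.

(** * Forests as commutative monomials, that is, multisets of trees *)

HB.instance Definition _ (I : choiceType) :=
  Monoid.isComLaw.Build {cmonom I} (onecm I) (@mulcm I)
    (@mulcmA I) (@mulcmC I) (@mul0cm I).

Lemma mulcmI (I : choiceType) (m : {cmonom I}) : injective (mulcm m).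
Proof.
move=> m1 m2 /eqP/cmP eq_m; apply/eqP/cmP => i.
by move: (eq_m i); rewrite !mulcmE => /addnI.
Qed.

Lemma ucm_neq1 (I : choiceType) (i : I) : ucm i <> onecm I.
Proof. by move/eqP/cmP/(_ i); rewrite ucmE onecmE eqxx. Qed.

(** Exponents of a monomial are multiplicities in its list, so identities of monomials and
    permutations of lists both reduce to comparing counts. *)
Lemma count_mlist (m : {cmonom utree}) u : count_mem u (mlist m) = m u.
Proof.
rewrite /mlist count_flatten -map_comp sumnE big_map.
under eq_bigr => v _ do rewrite /= count_nseq /=.
have [u_out|u_in] := finsuppP m u.
  rewrite big1_fset // => v v_in _; case: eqP => // vu.
  by rewrite -vu v_in in u_out.
rewrite (big_fsetD1 u) //= eqxx mul1n big1_fset ?addn0 // => v.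
by rewrite in_fsetD1 => /andP[/negPf->].
Qed.

Lemma mlistM (m m' : {cmonom utree}) :
  perm_eq (mlist (mulcm m m')) (mlist m ++ mlist m').
Proof. by apply/allP => u _ /=; rewrite count_cat !count_mlist mulcmE. Qed.

Lemma mlist1 : mlist (onecm utree) = [::].
Proof.
apply/nilP; rewrite /nilp -all_pred0; apply/allP => u.
by rewrite -has_pred1 has_count count_mlist onecmE.
Qed.

Lemma mlistU u : mlist (ucm u) = [:: u].
Proof.
by apply: perm_small_eq => //; apply/allP => v _ /=; rewrite count_mlist ucmE addn0.
Qed.

Lemma mlist_prod (s : seq utree) :
  perm_eq (mlist (\big[@mulcm utree/onecm utree]_(u <- s) ucm u)) s.
Proof.
elim: s => [|u s IHs]; first by rewrite big_nil mlist1.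
rewrite big_cons; apply: perm_trans (mlistM _ _) _.
by rewrite mlistU /= perm_cons.
Qed.

Lemma prod_mlist (m : {cmonom utree}) :
  \big[@mulcm utree/onecm utree]_(u <- mlist m) ucm u = m.
Proof.
apply/eqP/cmP => u; rewrite -!count_mlist.
by have /permP -> := mlist_prod (mlist m); rewrite count_mlist.
Qed.

Lemma tle_anti : antisymmetric tle.
Proof.
by move=> a b /anti_leq /(pcan_inj (@choice.pickleK _)).
Qed.

Lemma tle_trans : transitive tle.
Proof. by move=> b a c; apply: leq_trans. Qed.

Lemma Bnode_perm (s s' : seq utree) : perm_eq s s' -> Bnode s = Bnode s'.
Proof.
move=> ss'; apply: val_inj => /=; congr (GenTree.Node _ _).
by apply/(perm_sortP tle_total tle_trans tle_anti)/perm_map.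
Qed.

Lemma Bplus_m_prod (s : seq utree) :
  Bplus_m (\big[@mulcm utree/onecm utree]_(u <- s) ucm u) = Bnode s.
Proof. exact/Bnode_perm/mlist_prod. Qed.

(** [tle] is a total order, so two sorted lists of children agree only when the multisets of
    children do. *)
Lemma Bplus_m_inj : injective Bplus_m.
Proof.
move=> m m' [] /(perm_sortP tle_total tle_trans tle_anti).
move=> /(perm_map_inj val_inj)/permP eq_m.
by apply/eqP/cmP => u; rewrite -!count_mlist.
Qed.

(** * The monomial of a forest poset *)

Section ForestMonomial.
Variables (T : finType) (r : rel T).
Implicit Types A B : {set T}.

Definition below A x := [set y in A | r y x & y != x].

Definition tops A := [set x in A | [forall y in A, r x y ==> (y == x)]].

(** [n] is fuel: the recursion runs on sets that shrink strictly, and any bound on the cardinality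
    suffices. *)
Fixpoint fmon_rec n A : {cmonom utree} :=
  if n is m.+1 then
    \big[@mulcm utree/onecm utree]_(x in tops A)
      ucm (Bplus_m (fmon_rec m (below A x)))
  else onecm utree.

(* Meaningful when [r] is a forest order; the recursion then reads the forest
   off its Hasse diagram, with the maximal elements as roots. *)
Definition fmon A := fmon_rec #|A| A.

Lemma card_below A x : x \in A -> (#|below A x| < #|A|)%N.
Proof.
move=> xA; apply: proper_card; apply/properP; split.
  by apply/subsetP => y; rewrite inE => /andP[].
by exists x; rewrite // inE eqxx !andbF.
Qed.

Lemma topsP A x :
  reflect (x \in A /\ forall y, y \in A -> r x y -> y = x) (x \in tops A).
Proof.
rewrite inE; apply: (iffP andP) => [] [xA x_max]; split=> //.
  by move=> y yA xy; apply/eqP; move/forall_inP: x_max => /(_ y yA)/implyP; apply.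
by apply/forall_inP => y yA; apply/implyP => xy; apply/eqP/x_max.
Qed.

Lemma tops_sub A x : x \in tops A -> x \in A.
Proof. by case/topsP. Qed.

Lemma fmon_rec_fuel n A : (#|A| <= n)%N -> fmon_rec n A = fmon A.
Proof.
rewrite /fmon => leAn.
have [m leAm] := ubnP #|A|; elim: m => // m IHm in A n leAn leAm *.
case: n leAn => [|n] leAn; first by case: #|A| leAn.
case cA: #|A| => [|k] /=.
  by rewrite big1 // => x /tops_sub; rewrite (cards0_eq cA) inE.
apply: eq_bigr => x /tops_sub xA; have lt_b := card_below xA.
rewrite (IHm (below A x) n) ?(IHm (below A x) k) //;
  by [rewrite -ltnS -cA | rewrite -ltnS (leq_trans lt_b) |
      rewrite (leq_trans lt_b)].
Qed.

Lemma fmonE A :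
  fmon A = \big[@mulcm utree/onecm utree]_(x in tops A)
             ucm (Bplus_m (fmon (below A x))).
Proof.
rewrite -(fmon_rec_fuel (leqnSn #|A|)) /=.
apply: eq_bigr => x /tops_sub xA.
by rewrite fmon_rec_fuel // ltnW ?card_below.
Qed.

Lemma fmon0 : fmon set0 = onecm utree.
Proof. by rewrite /fmon cards0. Qed.

Definition incomparable A B :=
  forall x y, x \in A -> y \in B -> ~~ r x y /\ ~~ r y x.

(** With no comparabilities across the two parts, the maximal elements of the union and the elements
    below each of them are computed inside one part. *)
Lemma fmonU A B : [disjoint A & B] -> incomparable A B ->
  fmon (A :|: B) = mulcm (fmon A) (fmon B).
Proof.
move=> dAB iAB.
have belowl x : x \in A -> below (A :|: B) x = below A x.
  move=> xA; apply/setP => y; rewrite !inE.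
  case yA: (y \in A) => //=; case yB: (y \in B) => //=.
  by have [_ /negPf->] := iAB x y xA yB.
have belowr x : x \in B -> below (A :|: B) x = below B x.
  move=> xB; apply/setP => y; rewrite !inE.
  case yB: (y \in B); rewrite ?orbT //= orbF; case yA: (y \in A) => //=.
  by have [/negPf-> _] := iAB y x yA xB.
have topsU : tops (A :|: B) = tops A :|: tops B.
  apply/setP => x; rewrite in_setU; apply/topsP/orP.
    case; rewrite inE => /orP[] xAB x_max; [left | right]; apply/topsP; split=> //.
      by move=> y yA; apply: x_max; rewrite inE yA.
    by move=> y yA; apply: x_max; rewrite inE yA orbT.
  case=> /topsP[xA x_max]; rewrite inE xA ?orbT; split=> // y; rewrite inE.
    by case/orP=> [/x_max//|yB]; have [/negPf->] := iAB x y xA yB.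
  by case/orP=> [yA|/x_max//]; have [_ /negPf->] := iAB y x yA xA.
have dtops : [disjoint tops A & tops B].
  by apply: disjointW dAB; apply/subsetP => x /tops_sub.
rewrite fmonE topsU (eq_bigl [predU tops A & tops B]); last first.
  by move=> x; rewrite !inE.
rewrite bigU //=.
congr mulcm; rewrite [RHS]fmonE; apply: eq_bigr => x /tops_sub xA.
  by rewrite belowl.
by rewrite belowr.
Qed.

Lemma fmon_top A x : x \in A -> (forall y, y \in A -> r y x) ->
  (forall y, y \in A -> r x y -> y = x) ->
  fmon A = ucm (Bplus_m (fmon (A :\ x))).
Proof.
move=> xA x_top x_max.
have -> : A :\ x = below A x.
  apply/setP => y; rewrite !inE andbC; case yA: (y \in A) => //=.
  by rewrite x_top.
rewrite fmonE (_ : tops A = [set x]) ?big_set1 //.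
apply/setP => y; rewrite in_set1; apply/topsP/eqP => [[yA y_max]|->].
  by apply/esym/y_max; rewrite ?x_top.
by split.
Qed.

End ForestMonomial.

(** Isomorphism invariance: the recursion sees only the order restricted to [A], hence conditions on
    [h] restricted to [A]. *)
Lemma fmon_imset (T U : finType) (r : rel T) (s : rel U) (h : T -> U)
    (A : {set T}) :
  {in A &, injective h} -> {in A &, forall x y, s (h x) (h y) = r x y} ->
  fmon s (h @: A) = fmon r A.
Proof.
have [m] := ubnP #|A|; elim: m => // m IHm in A *.
move=> leAm h_inj h_ord; rewrite !(fmonE _ A) fmonE.
have -> : tops s (h @: A) = h @: tops r A.
  apply/setP => u; apply/topsP/imsetP.
    case=> /imsetP[x xA ->{u}] x_max; exists x => //; apply/topsP; split=> // y yA.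
    by rewrite -h_ord // => /(x_max _ (imset_f h yA))/h_inj; apply.
  case=> x /topsP[xA x_max] ->{u}; rewrite imset_f //; split=> // _ /imsetP[y yA ->].
  by rewrite h_ord // => /(x_max _ yA) ->.
rewrite big_imset /=; last by move=> x y /tops_sub xA /tops_sub yA; apply: h_inj.
apply: eq_bigr => x /tops_sub xA; congr (ucm (Bplus_m _)).
have subA : {subset below r A x <= A} by move=> y; rewrite inE => /andP[].
have -> : below s (h @: A) (h x) = h @: below r A x.
  apply/setP => u; rewrite inE; apply/andP/imsetP.
    case=> /imsetP[y yA ->{u}]; rewrite h_ord // (inj_in_eq h_inj) // => yx.
    by exists y; rewrite // inE yA.
  case=> y; rewrite inE => /andP[yA yx] ->{u}.
  by rewrite imset_f // h_ord // (inj_in_eq h_inj).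
apply: IHm; first exact: leq_trans (card_below r xA) _.
  by move=> y z /subA yA /subA zA; apply: h_inj.
by move=> y z /subA yA /subA zA; apply: h_ord.
Qed.

(** * Forest orders and their reconstruction from the monomial *)

Record forest_order (T : finType) (r : rel T) : Prop := ForestOrder {
  fo_refl : reflexive r;
  fo_anti : antisymmetric r;
  fo_trans : transitive r;
  fo_chain : forall x y z, r x y -> r x z -> r y z || r z y
}.

(** An element with the fewest elements below it is minimal. *)
Lemma poset_minimal (T : finType) (r : rel T) (A : {set T}) :
  reflexive r -> antisymmetric r -> transitive r -> A != set0 ->
  exists2 x, x \in A & forall y, y \in A -> r y x -> y = x.
Proof.
move=> rr ra rt /set0Pn[x0 x0A].
case: (arg_minnP (fun x => #|[set y | r y x]|) x0A) => x xA x_min.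
exists x => // y yA yx; apply/eqP; apply: contraT => y_neq.
suff: (#|[set z | r z y]| < #|[set z | r z x]|)%N by rewrite ltnNge x_min.
apply: proper_card; apply/properP; split.
  by apply/subsetP => z; rewrite !inE => zy; apply: rt yx.
exists x; rewrite !inE ?rr //; apply: contra y_neq => xy.
by apply/eqP/ra; rewrite yx.
Qed.

Section ForestOrder.
Variables (T : finType) (r : rel T).
Hypothesis fo : forest_order r.
Implicit Types A B : {set T}.

Lemma tops_neq0 A : A != set0 -> exists x, x \in tops r A.
Proof.
case: fo => rr ra rt _ A0.
have [//|||x xA x_max] := @poset_minimal _ (fun x y => r y x) A _ _ _ A0.
- by move=> x y; rewrite andbC; apply: ra.
- by move=> y x z yx zy; apply: rt yx.
by exists x; apply/topsP.
Qed.

Lemma fmon_eq1 A : fmon r A = onecm utree -> A = set0.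
Proof.
move=> fA; apply/eqP; apply: contraT => /tops_neq0[x x_top].
move: fA; rewrite fmonE (bigD1 x) //= => /mulcm_eq0[].
by move/ucm_neq1.
Qed.

(* Up-sets of points are chains, so an element below [x] and one not below [x]
   are never comparable when [x] is maximal. *)
Lemma tops_split A x : x \in tops r A ->
  let C := below r A x in let B := A :\: (x |: C) in
  [/\ A = (x |: C) :|: B, x \notin C, {in C, forall y, r y x},
      [disjoint x |: C & B] & incomparable r (x |: C) B].
Proof.
case: fo => rr ra rt rc /topsP[xA x_max] C B.
have CA : {subset C <= A} by move=> y; rewrite inE => /andP[].
have xCP y : (y \in x |: C) = (y \in A) && r y x.
  rewrite !inE; case: (eqVneq y x) => [->|_] /=; first by rewrite xA rr.
  by rewrite andbT.
have BP y : (y \in B) = (y \in A) && ~~ r y x.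
  by rewrite inE xCP negb_and andb_orl andNb /= andbC.
split.
- by apply/setP => y; rewrite in_setU xCP BP; case: (y \in A); case: (r y x).
- by rewrite inE eqxx !andbF.
- by move=> y; rewrite inE => /and3P[].
- rewrite -setI_eq0; apply/eqP/setP => y.
  by rewrite in_setI in_set0 xCP BP; case: (y \in A); case: (r y x).
move=> y z; rewrite xCP BP => /andP[yA yx] /andP[zA zx]; split.
  apply/negP => yz; case/orP: (rc _ _ _ yx yz) => [xz|]; last by apply/negP.
  by move: zx; rewrite (x_max z zA xz) rr.
by apply: contra zx => zy; apply: rt yx.
Qed.

Lemma fmon_split A x : x \in tops r A ->
  fmon r A = mulcm (ucm (Bplus_m (fmon r (below r A x))))
                   (fmon r (A :\: (x |: below r A x))).
Proof.
move=> x_top; have [AE xC Cx dis inc] := tops_split x_top.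
rewrite {1}AE fmonU //; congr mulcm.
rewrite (@fmon_top _ _ _ x) ?setU11 ?setU1K //.
  by move=> y /setU1P[->|/Cx//]; apply: fo_refl.
move=> y yC xy; apply: (fo_anti fo); rewrite xy andbT.
by case/setU1P: yC => [->|/Cx//]; apply: fo_refl.
Qed.

(** Induction that detaches one whole tree: its root [x], the forest under [x], and the remaining
    trees. *)
Lemma forest_order_ind (P : {set T} -> Prop) :
  P set0 ->
  (forall (A : {set T}) x, x \in tops r A -> P (below r A x) ->
     P (A :\: (x |: below r A x)) -> P A) ->
  forall A, P A.
Proof.
move=> P0 PS A; have [m] := ubnP #|A|; elim: m => // m IHm in A *.
move=> leAm; rewrite ltnS in leAm; have [->//|/tops_neq0[x x_top]] := eqVneq A set0.
have xA := tops_sub x_top.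
apply: (PS A x x_top); apply: IHm.
  exact: leq_trans (card_below r xA) _.
apply: leq_trans leAm; apply: proper_card; apply/properP; split.
  exact: subsetDl.
by exists x; rewrite // !inE eqxx.
Qed.

End ForestOrder.

(** The tree of a root of [A] must occur among the trees of [B]. Injectivity of [B^+] matches the
    forests under the two roots, cancellation matches the rest, and the two isomorphisms are glued.
    The point [u0] is the value of the map when [A] is empty. *)
Lemma fmon_eq_iso (T U : finType) (r : rel T) (s : rel U) (u0 : U)
    (A : {set T}) (B : {set U}) :
  forest_order r -> forest_order s -> fmon r A = fmon s B ->
  exists f : T -> U, [/\ {in A &, injective f}, f @: A = B &
    {in A &, forall x y, s (f x) (f y) = r x y}].
Proof.
move=> fr fs; move: A B; apply: (forest_order_ind fr) => [B|A x xt IHC IHA B].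
  rewrite fmon0 => /esym/(fmon_eq1 fs) ->.
  by exists (fun=> u0); split=> [x||x]; rewrite ?imset0 ?inE.
move=> eqAB.
have [AE xC Cx dA iA] := tops_split fr xt.
(* The tree at [x] has positive exponent in the monomial of [B], so some factor of the product over
   [tops s B] equals it. *)
have [y yt Dy] : exists2 y, y \in tops s B &
    Bplus_m (fmon s (below s B y)) = Bplus_m (fmon r (below r A x)).
  move: eqAB; rewrite (fmon_split fr xt) => /esym/eqP/cmP.
  move/(_ (Bplus_m (fmon r (below r A x)))).
  rewrite mulcmE ucmE eqxx add1n fmonE => pos.
  have: (0 < (\big[@mulcm utree/onecm utree]_(x0 in tops s B)
    ucm (Bplus_m (fmon s (below s B x0)))) (Bplus_m (fmon r (below r A x))))%N.
    by rewrite pos.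
  move=> {pos}; elim/big_rec: _ => [|y m yt IHy]; first by rewrite onecmE.
  rewrite mulcmE ucmE; case: eqP => [<- _|_]; first by exists y.
  exact: IHy.
have [BE yD Dy' dB iB] := tops_split fs yt.
move: eqAB; rewrite (fmon_split fr xt) (fmon_split fs yt) Dy => /mulcmI eqAB.
move/Bplus_m_inj: Dy => /esym eqCD.
have {IHC eqCD}[f [f_inj fC f_ord]] := IHC _ eqCD.
have {IHA eqAB}[g [g_inj gA g_ord]] := IHA _ eqAB.
set C := below r A x in AE xC Cx dA iA f_inj fC f_ord g_inj gA g_ord *.
set D := below s B y in BE yD Dy' dB iB fC gA *.
set A' := A :\: _ in AE dA iA g_inj gA g_ord *.
set B' := B :\: _ in BE dB iB gA *.
have fD z : z \in C -> f z \in D by move=> zC; rewrite -fC imset_f.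
have gB z : z \in A' -> g z \in B' by move=> zC; rewrite -gA imset_f.
have A'C z : z \in A' -> (z \in C = false) * ((z == x) = false).
  by rewrite !inE negb_or => /andP[/andP[/negPf-> /negPf->]].
have B'D z : z \in B' -> (z \in D = false) * ((z == y) = false).
  by rewrite !inE negb_or => /andP[/andP[/negPf-> /negPf->]].
have yDF z : z \in D -> (z == y) = false.
  by case: eqP => // ->; rewrite (negPf yD).
have xCF z : z \in C -> (z == x) = false.
  by case: eqP => // ->; rewrite (negPf xC).
(* The glued map: [f] under the root, root to root, and [g] on the other trees. *)
pose h z := if z \in C then f z else if z == x then y else g z.
have hC z : z \in C -> h z = f z by rewrite /h => ->.
have hx : h x = y by rewrite /h (negPf xC) eqxx.
have hA z : z \in A' -> h z = g z by move=> zA; rewrite /h !(A'C z zA).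
have AP z : z \in A -> [\/ z \in C, z = x | z \in A'].
  rewrite AE inE in_setU1 => /orP[/orP[/eqP->|zC]|zA'].
  - by constructor 2.
  - by constructor 1.
  - by constructor 3.
have rF z w : z \in x |: C -> w \in A' -> (r z w = false) * (r w z = false).
  by move=> zC wA; have [/negPf-> /negPf->] := iA z w zC wA.
have sF z w : z \in y |: D -> w \in B' -> (s z w = false) * (s w z = false).
  by move=> zC wA; have [/negPf-> /negPf->] := iB z w zC wA.
have CxF z : z \in C -> r x z = false.
  move=> zC; apply/negP => xz; have := xCF z zC.
  by rewrite (fo_anti fr (x := z) (y := x)) ?eqxx // xz Cx.
have DyF z : z \in D -> s y z = false.
  move=> zC; apply/negP => xz; have := yDF z zC.
  by rewrite (fo_anti fs (x := z) (y := y)) ?eqxx // xz Dy'.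
have h_ord : {in A &, forall x y, s (h x) (h y) = r x y}.
  move=> z w /AP[zC|->|zA] /AP[wC|->|wA]; rewrite ?hx.
  - by rewrite !hC // f_ord.
  - by rewrite hC // Cx // Dy' ?fD.
  - by rewrite hC // hA // (rF z w) ?(sF (f z) (g w)) ?in_setU1 ?zC ?fD ?orbT ?gB.
  - by rewrite hC // CxF ?DyF ?fD.
  - by rewrite !fo_refl.
  - by rewrite hA // (rF x w) ?(sF y (g w)) ?setU11 ?gB.
  - by rewrite (hC w) // hA // (rF w z) ?(sF (f w) (g z)) ?in_setU1 ?wC ?fD ?orbT ?gB.
  - by rewrite hA // (rF x z) ?(sF y (g z)) ?setU11 ?gB.
  - by rewrite !hA // g_ord.
(* Injectivity follows from [h_ord]: points with equal images are comparable in both directions. *)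
exists h; split=> //.
  move=> z w zA wA hzw; apply: (fo_anti fr).
  by rewrite -(h_ord z w) // -(h_ord w z) // hzw (fo_refl fs).
rewrite AE !imsetU imset_set1 hx BE -fC -gA.
congr (_ :|: _ :|: _); apply: eq_in_imset => z; [exact: hC|exact: hA].
Qed.

(** * Birkhoff duality for lattices of down-sets *)

Definition fp_rel (P : fposet) : rel 'I_(tag P) := fun i j => tagged P (i, j).

Definition fp_embedding (P : fposet) (T : finType) (A : {set T}) (r : rel T)
    (f : 'I_(tag P) -> T) :=
  [/\ injective f, f @: setT = A & forall i j, fp_rel i j = r (f i) (f j)].

(** Posets are coded on ordinals; this isomorphism with a subset of an arbitrary finite type lets
    the arguments take place on families of sets. *)
Definition represents (P : fposet) (T : finType) (A : {set T}) (r : rel T) :=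
  exists f : 'I_(tag P) -> T, fp_embedding A r f.

Lemma represents_fp_of (T : finType) (A : {set T}) (r : rel T) :
  represents (fp_of A r) A r.
Proof.
exists (fun i => enum_val i); split.
- exact: enum_val_inj.
- apply/setP => x; apply/imsetP/idP => [[i _ ->]|xA]; first exact: enum_valP.
  by exists (enum_rank_in xA x); rewrite ?enum_rankK_in.
- by move=> i j; rewrite /fp_rel ffunE.
Qed.

Lemma represents_self P : represents P setT (@fp_rel P).
Proof. by exists id; split=> //; rewrite imset_id. Qed.

Lemma represents_imset P (T U : finType) (A : {set T}) (r : rel T)
    (s : rel U) (h : T -> U) :
  represents P A r -> {in A &, injective h} ->
  {in A &, forall x y, s (h x) (h y) = r x y} -> represents P (h @: A) s.
Proof.
case=> f [f_inj fA f_ord] h_inj h_ord.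
have fA' i : f i \in A by rewrite -fA imset_f.
exists (h \o f); split=> [i j /= /h_inj /f_inj -> //||i j /=].
  by rewrite imset_comp fA.
by rewrite h_ord.
Qed.

Lemma fp_isoP P Q : reflect (represents P setT (@fp_rel Q)) (fp_iso P Q).
Proof.
apply: (iffP andP) => [[/eqP eqPQ /existsP[f /andP[/injectiveP f_inj f_ord]]]|].
  exists f; split=> //; last first.
    by move=> i j; move/forallP/(_ i)/forallP/(_ j)/eqP: f_ord.
  apply/eqP; rewrite eqEcard subsetT /= cardsT card_imset //.
  by rewrite cardsT !card_ord eqPQ.
case=> f [f_inj f_im f_ord]; split.
  move: (congr1 (fun A : {set _} => #|A|) f_im) => /eqP.
  by rewrite card_imset // !cardsT !card_ord.
apply/existsP; exists [ffun i => f i]; apply/andP; split.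
  by apply/injectiveP => i j; rewrite !ffunE => /f_inj.
by apply/forallP => i; apply/forallP => j; rewrite !ffunE; apply/eqP/f_ord.
Qed.

Lemma represents_iso P Q (T : finType) (A : {set T}) (r : rel T) :
  represents P A r -> represents Q A r -> fp_iso P Q.
Proof.
case=> f [f_inj fA f_ord] [g [g_inj gA g_ord]]; apply/fp_isoP.
have [h fg] : exists h : 'I_(tag P) -> 'I_(tag Q), forall i, f i = g (h i).
  apply: (@fin_all_exists _ (fun=> 'I_(tag Q)) (fun i j => f i = g j)) => i.
  have : f i \in A by rewrite -fA imset_f.
  by rewrite -gA => /imsetP[j _ ->]; exists j.
exists h; split=> [i j hij||i j].
- by apply: f_inj; rewrite !fg hij.
- apply/setP => j; rewrite inE; have : g j \in A by rewrite -gA imset_f.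
  by rewrite -fA => /imsetP[i _]; rewrite fg => /g_inj ->; rewrite imset_f.
- by rewrite f_ord !fg g_ord.
Qed.

Lemma iso_represents P Q (T : finType) (A : {set T}) (r : rel T) :
  fp_iso P Q -> represents Q A r -> represents P A r.
Proof.
move=> /fp_isoP isoPQ [f [f_inj <- f_ord]].
by apply: represents_imset isoPQ _ _ => [i j _ _ /f_inj|i j _ _] //.
Qed.

Lemma fp_iso_refl P : fp_iso P P.
Proof. exact/fp_isoP/represents_self. Qed.

Lemma fp_iso_sym P Q : fp_iso P Q -> fp_iso Q P.
Proof.
by move=> /iso_represents-/(_ _ _ _ (represents_self Q))/(represents_iso _); apply;
  apply: represents_self.
Qed.

Lemma fp_iso_trans P Q S : fp_iso P Q -> fp_iso Q S -> fp_iso P S.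
Proof. by move=> isoPQ /fp_isoP repQ; apply/fp_isoP/(iso_represents isoPQ). Qed.

Lemma fp_canon_iso P : fp_iso P (fp_canon P).
Proof.
rewrite /fp_canon; case: arg_minnP => //.
by case: P => n r; apply: fp_iso_refl.
Qed.

(** Both canonical forms minimize [enum_rank] over the same isomorphism class of relations on the
    same ordinal. *)
Lemma fp_canon_eq P Q : fp_iso P Q -> fp_canon P = fp_canon Q.
Proof.
move=> isoPQ; have /eqP eqPQ : tag P == tag Q by case/andP: isoPQ.
case: P Q eqPQ isoPQ => n r [m s] /= eqnm; rewrite -{}eqnm in s * => isoPQ.
rewrite /fp_canon /=; congr mkfp.
case: arg_minnP => [|r1 iso1 min1]; first exact: fp_iso_refl.
case: arg_minnP => [|r2 iso2 min2]; first exact: fp_iso_refl.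
apply/enum_rank_inj/val_inj/anti_leq.
rewrite min1 ?min2 //; first exact: fp_iso_trans (fp_iso_sym isoPQ) iso1.
exact: fp_iso_trans isoPQ iso2.
Qed.

(** * Lattices of down-sets and their join-irreducible elements *)

Section Downsets.
Variables (T : finType) (r : rel T).
Implicit Types A D : {set T}.

Definition downsets A : {set {set T}} :=
  [set D : {set T} | (D \subset A) &&
     [forall x in A, forall y in D, r x y ==> (x \in D)]].

Definition subrel_set : rel {set T} := fun D E => D \subset E.

Lemma downsetsP A D :
  reflect (D \subset A /\ forall x y, x \in A -> y \in D -> r x y -> x \in D)
          (D \in downsets A).
Proof.
rewrite inE; apply: (iffP andP) => [] [DA Dd]; split=> //.
  move=> x y xA yD; move/forall_inP/(_ x xA)/forall_inP/(_ y yD): Dd.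
  by move/implyP.
apply/forall_inP => x xA; apply/forall_inP => y yD; apply/implyP.
exact: Dd.
Qed.

End Downsets.

(** Join-irreducibility is expressed by order alone: the elements strictly below [j] have a greatest
    one, [c]. This excludes the bottom. *)
Definition join_irr (T : finType) (r : rel T) (A : {set T}) : {set T} :=
  [set j in A | [exists c in A,
     [&& c != j, r c j & [forall x in A, r x j && (x != j) ==> r x c]]]].

Lemma join_irrP (T : finType) (r : rel T) (A : {set T}) j :
  reflect (j \in A /\ exists c, [/\ c \in A, c <> j, r c j &
             forall x, x \in A -> r x j -> x <> j -> r x c])
          (j \in join_irr r A).
Proof.
rewrite inE; apply: (iffP andP) => [] [jA].
  case/exists_inP => c cA /and3P[/eqP cj rcj /forall_inP c_max]; split=> //.
  exists c; split=> // x xA xj /eqP xNj.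
  by move/implyP: (c_max x xA); apply; rewrite xj.
case=> c [cA cj rcj c_max]; split=> //; apply/exists_inP; exists c => //.
apply/and3P; split=> //; first exact/eqP.
by apply/forall_inP => x xA; apply/implyP => /andP[xj /eqP]; apply: c_max.
Qed.

Lemma join_irr_imset (T U : finType) (r : rel T) (s : rel U) (h : T -> U)
    (A : {set T}) :
  {in A &, injective h} -> {in A &, forall x y, s (h x) (h y) = r x y} ->
  join_irr s (h @: A) = h @: join_irr r A.
Proof.
move=> h_inj h_ord; apply/setP => u; apply/join_irrP/imsetP.
  case=> /imsetP[j jA ->{u}] [_ [/imsetP[c cA ->]]].
  rewrite h_ord // => cj rcj c_max; exists j => //.
  apply/join_irrP; split=> //; exists c; split=> // [|x xA xj xNj].
    by move=> eq_cj; apply: cj; rewrite eq_cj.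
  rewrite -h_ord // c_max ?imset_f ?h_ord //.
  by move/h_inj => /(_ xA jA).
case=> j /join_irrP[jA [c [cA cj rcj c_max]]] ->{u}.
rewrite imset_f //; split=> //; exists (h c); rewrite imset_f ?h_ord //; split=> //.
  by move/h_inj => /(_ cA jA).
move=> _ /imsetP[x xA ->]; rewrite !h_ord // => xj xNj; apply: c_max => //.
by move=> eq_xj; apply: xNj; rewrite eq_xj.
Qed.

(** The join-irreducible down-sets are the principal ones; the unique lower cover of the down-set of
    [x] is obtained by removing [x]. *)
Lemma join_irr_downsets (T : finType) (r : rel T) (A : {set T}) :
  reflexive r -> antisymmetric r -> transitive r ->
  join_irr (@subrel_set T) (downsets r A) = (fun x => [set y in A | r y x]) @: A.
Proof.
move=> rr ra rt; set dn := fun x => _.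
have dn_down x : dn x \in downsets r A.
  apply/downsetsP; split; first by apply/subsetP => y; rewrite inE => /andP[].
  by move=> y z yA; rewrite !inE yA => /andP[_ zx] yz; apply: rt zx.
apply/setP => D; apply/join_irrP/imsetP.
  case=> /downsetsP[DA Dd] [C [/downsetsP[CA Cd] CD sCD C_max]].
  (* Take [x] in [D] outside the lower cover [C]. The principal down-set of [x] lies in [D]; if it
     were proper it would lie in [C] and put [x] there. *)
  have /subsetPn[x xD xC] : ~~ (D \subset C).
    by apply: contra_notN CD => sDC; apply/eqP; rewrite eqEsubset sDC andbT.
  have xA := subsetP DA x xD; exists x => //.
  have sxD : dn x \subset D.
    by apply/subsetP => y; rewrite inE => /andP[yA]; apply: Dd.
  apply/eqP; rewrite eq_sym; apply: contraT => /eqP xND.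
  have /subsetP/(_ x) : dn x \subset C by apply: C_max.
  by rewrite inE xA rr (negPf xC) => /(_ isT).
case=> x xA ->; split=> //; exists (dn x :\ x).
have x_dn : x \in dn x by rewrite inE xA rr.
split.
- apply/downsetsP; split; first by apply/subsetP => y; rewrite !inE => /and3P[].
  move=> y z yA; rewrite !inE yA => /and3P[zNx zA zx] yz; rewrite (rt _ _ _ yz zx).
  rewrite /= andbT; apply: contra zNx => /eqP yx; apply/eqP/ra.
  by rewrite zx -yx yz.
- by move/setP/(_ x); rewrite x_dn !inE eqxx.
- by apply/subsetP => y /setD1P[].
- move=> E /downsetsP[EA Ed] + /eqP ENx.
  rewrite /subrel_set => Ex; rewrite subsetD1 Ex /=.
  apply: contra ENx => xE; rewrite eqEsubset Ex.
  by apply/subsetP => y; rewrite inE => /andP[yA]; apply: Ed.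
Qed.

(** Inverse direction of Birkhoff duality, defined for every finite poset and meaningful when [P] is
    the lattice of down-sets of a forest. *)
Definition birkhoff_mon (P : fposet) : {cmonom utree} :=
  fmon (@fp_rel P) (join_irr (@fp_rel P) setT).

Lemma birkhoff_mon_represents P (T : finType) (A : {set T}) (r : rel T) :
  represents P A r -> birkhoff_mon P = fmon r (join_irr r A).
Proof.
case=> f [f_inj <- f_ord]; rewrite (@join_irr_imset _ _ (@fp_rel P)) //.
- by rewrite (fmon_imset (r := @fp_rel P)) // => i j _ _; apply: f_inj.
- by move=> i j _ _; apply: f_inj.
Qed.

Definition forest_lattice (P : fposet) (m : {cmonom utree}) : Prop :=
  exists (T : finType) (r : rel T) (A : {set T}),
    [/\ forest_order r, represents P (downsets r A) (@subrel_set T) &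
        fmon r A = m].

(** Sending a point to its principal down-set embeds the forest onto the join-irreducible elements.
    In particular [m] is determined by [P]. *)
Lemma forest_lattice_birkhoff P m : forest_lattice P m -> birkhoff_mon P = m.
Proof.
case=> T [r [A [fr rP <-]]]; rewrite (birkhoff_mon_represents rP).
case: (fr) => rr ra rt _; rewrite join_irr_downsets //.
have dn_ord : {in A &, forall x y,
    subrel_set [set z in A | r z x] [set z in A | r z y] = r x y}.
  move=> x y xA yA; apply/subsetP/idP => [/(_ x)|xy z]; rewrite !inE ?xA ?rr //=.
    exact.
  by case/andP=> -> zx; apply: rt xy.
rewrite (fmon_imset (r := r)) //= => x y xA yA /= eq_dn; apply: ra.
by rewrite -!dn_ord // eq_dn /subrel_set !subxx.
Qed.

Lemma forest_lattice_iso P Q m :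
  fp_iso P Q -> forest_lattice Q m -> forest_lattice P m.
Proof.
move=> isoPQ [T [r [A [fr rQ fA]]]]; exists T, r, A; split=> //.
exact: iso_represents isoPQ rQ.
Qed.

Lemma downsets_imset (T U : finType) (r : rel T) (s : rel U) (h : T -> U)
    (A : {set T}) :
  {in A &, injective h} -> {in A &, forall x y, s (h x) (h y) = r x y} ->
  downsets s (h @: A) = (fun D : {set T} => h @: D) @: downsets r A.
Proof.
move=> h_inj h_ord; apply/setP => E; apply/downsetsP/imsetP.
  case=> EA Ed; exists [set x in A | h x \in E].
    apply/downsetsP; split; first by apply/subsetP => x; rewrite inE => /andP[].
    move=> x y xA; rewrite !inE xA => /andP[yA yE] xy.
    by apply: Ed yE _; rewrite ?imset_f ?h_ord.
  apply/setP => u; apply/idP/imsetP => [uE|[x]]; last by rewrite inE => /andP[_] + ->.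
  have /imsetP[x xA ux] := subsetP EA u uE.
  by exists x; rewrite // inE xA -ux.
case=> D /downsetsP[DA Dd] ->{E}; split; first exact: imsetS.
move=> _ _ /imsetP[x xA ->] /imsetP[y yD ->]; have yA := subsetP DA y yD.
by rewrite h_ord // => xy; rewrite imset_f // (Dd x y).
Qed.

Lemma imset_subset (T U : finType) (h : T -> U) (A D E : {set T}) :
  {in A &, injective h} -> D \subset A -> E \subset A ->
  (h @: D \subset h @: E) = (D \subset E).
Proof.
move=> h_inj DA EA; apply/idP/idP => [/subsetP sDE|]; last exact: imsetS.
apply/subsetP => x xD; have /imsetP[y yE] := sDE _ (imset_f h xD).
by move/(h_inj _ _ (subsetP DA x xD) (subsetP EA y yE)) ->.
Qed.

Lemma represents_downsets_imset P (T U : finType) (r : rel T) (s : rel U)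
    (h : T -> U) (A : {set T}) :
  {in A &, injective h} -> {in A &, forall x y, s (h x) (h y) = r x y} ->
  represents P (downsets r A) (@subrel_set T) ->
  represents P (downsets s (h @: A)) (@subrel_set U).
Proof.
move=> h_inj h_ord rP; rewrite (downsets_imset h_inj h_ord).
apply: represents_imset rP _ _ => D E /downsetsP[DA _] /downsetsP[EA _].
  move=> eqDE; apply/eqP; rewrite eqEsubset.
  by rewrite -(imset_subset h_inj DA EA) -(imset_subset h_inj EA DA) eqDE subxx.
exact: imset_subset h_inj _ _.
Qed.

(** Equal monomials give isomorphic forests, and isomorphic forests have isomorphic lattices of
    down-sets. *)
Lemma forest_lattice_inj P Q m :
  forest_lattice P m -> forest_lattice Q m -> fp_iso P Q.
Proof.
case=> T [r [A [fr rP fA]]] [U [s [B [fs rQ fB]]]].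
(* [option U] provides a default value when [U] is empty. *)
pose s' (u v : option U) :=
  if u is Some x then if v is Some y then s x y else false else v == None.
have fs' : forest_order s'.
  case: fs => sr sa st sc; split.
  - by case=> //= x.
  - by move=> [x|] [y|] //= /sa ->.
  - by move=> [x|] [y|] [z|] //=; apply: st.
  - by move=> [x|] [y|] [z|] //=; apply: sc.
have Sinj : {in B &, injective (@Some U)} by move=> x y _ _ [].
have {}rQ := represents_downsets_imset (s := s') Sinj (fun _ _ _ _ => erefl) rQ.
have fB' : fmon s' (Some @: B) = fmon s B by apply: fmon_imset.
have [f [f_inj fA' f_ord]] :
    exists f : T -> option U, [/\ {in A &, injective f}, f @: A = Some @: B &
      {in A &, forall x y, s' (f x) (f y) = r x y}].
  by apply: fmon_eq_iso => //; [exact: None | rewrite fB' fA fB].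
move: rQ; rewrite -fA' => rQ.
exact: represents_iso (represents_downsets_imset f_inj f_ord rP) rQ.
Qed.

Lemma downsets0 (T : finType) (r : rel T) : downsets r set0 = [set set0].
Proof.
apply/setP => D; rewrite in_set1; apply/downsetsP/eqP => [[]|->].
  by rewrite subset0 => /eqP.
by split=> // x y; rewrite inE.
Qed.

Lemma forest_lattice_pt : forest_lattice fp_pt (onecm utree).
Proof.
exists 'I_0, (fun _ _ => true), set0; split.
- by split=> // -[].
- exists (fun=> set0); split; first by move=> i j _; rewrite !ord1.
  + rewrite downsets0; apply/setP => D; rewrite in_set1.
    apply/imsetP/eqP => [[]//|->]; by exists ord0.
  + by move=> i j; rewrite /fp_rel ffunE /subrel_set subxx.
- exact: fmon0.
Qed.

(** * Disjoint sums of forests and products of lattices *)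

Section Products.
Variables (T U : finType) (r : rel T) (s : rel U).

Definition sum_rel : rel (T + U) := fun u v =>
  match u, v with
  | inl x, inl y => r x y
  | inr x, inr y => s x y
  | _, _ => false
  end.

Lemma sum_forest_order :
  forest_order r -> forest_order s -> forest_order sum_rel.
Proof.
case=> rr ra rt rc [sr sa st sc]; split.
- by case.
- by move=> [x|x] [y|y] //=; [move/ra->|move/sa->].
- by move=> [x|x] [y|y] [z|z] //=; [apply: rt|apply: st].
- by move=> [x|x] [y|y] [z|z] //=; [apply: rc|apply: sc].
Qed.

Definition sum_set (D : {set T}) (E : {set U}) : {set T + U} :=
  inl @: D :|: inr @: E.

Lemma sum_setl D E x : (inl x \in sum_set D E) = (x \in D).
Proof.
rewrite inE mem_imset ?orbF; last by move=> ? ? [].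
by apply/orb_idr => /imsetP[].
Qed.

Lemma sum_setr D E x : (inr x \in sum_set D E) = (x \in E).
Proof.
rewrite inE (mem_imset (f := inr)) ?orbF; last by move=> ? ? [].
by apply/orb_idl => /imsetP[].
Qed.

Lemma sum_subset D E D' E' :
  (sum_set D E \subset sum_set D' E') = (D \subset D') && (E \subset E').
Proof.
apply/subsetP/andP => [sub|[/subsetP sD /subsetP sE] [x|x]].
- split; apply/subsetP => x xD.
    by rewrite -(sum_setl _ E') sub ?sum_setl.
  by rewrite -(sum_setr D') sub ?sum_setr.
- by rewrite !sum_setl; apply: sD.
- by rewrite !sum_setr; apply: sE.
Qed.

Lemma downsets_sum A B (F : {set T + U}) :
  reflect (exists D E, [/\ D \in downsets r A, E \in downsets s B &
                           F = sum_set D E])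
          (F \in downsets sum_rel (sum_set A B)).
Proof.
apply: (iffP (downsetsP _ _ _)) => [[FAB Fd]|[D [E [/downsetsP[DA Dd] /downsetsP[EB Ed] ->]]]].
  exists [set x | inl x \in F], [set x | inr x \in F].
  split; last by apply/setP => -[x|x]; rewrite ?sum_setl ?sum_setr inE.
    apply/downsetsP; split.
      by apply/subsetP => x; rewrite inE => /(subsetP FAB); rewrite sum_setl.
    move=> x y xA; rewrite !inE => yF xy; apply: Fd yF _ => //.
    by rewrite sum_setl.
  apply/downsetsP; split.
    by apply/subsetP => x; rewrite inE => /(subsetP FAB); rewrite sum_setr.
  move=> x y xA; rewrite !inE => yF xy; apply: Fd yF _ => //.
  by rewrite sum_setr.
split; first by rewrite sum_subset DA.
by move=> [x|x] [y|y]; rewrite ?sum_setl ?sum_setr //; [apply: Dd|apply: Ed].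
Qed.

Lemma fmon_sum A B : fmon sum_rel (sum_set A B) = mulcm (fmon r A) (fmon s B).
Proof.
rewrite fmonU.
- congr mulcm; apply: fmon_imset => //; by [move=> x y _ _ []].
- rewrite -setI_eq0; apply/eqP/setP => u; rewrite !inE.
  by apply/negP => /andP[/imsetP[x _ ->] /imsetP[]].
- by move=> _ _ /imsetP[x _ ->] /imsetP[y _ ->].
Qed.

End Products.

(** A down-set of a disjoint sum is a pair of down-sets, and inclusion is componentwise. *)
Lemma forest_lattice_prod P Q m m' :
  forest_lattice P m -> forest_lattice Q m' ->
  forest_lattice (fp_prod P Q) (mulcm m m').
Proof.
case=> T [r [A [fr [f [f_inj fA f_ord]] <-]]].
case=> U [s [B [fs [g [g_inj gB g_ord]] <-]]].
exists (T + U)%type, (sum_rel r s), (sum_set A B); split.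
- exact: sum_forest_order.
- set h := fun ij : 'I_(tag P) * 'I_(tag Q) => sum_set (f ij.1) (g ij.2).
  have <- : h @: setT = downsets (sum_rel r s) (sum_set A B).
    apply/setP => F; apply/imsetP/downsets_sum.
      case=> [[i j] _ ->]; exists (f i), (g j).
      by rewrite -fA -gB !imset_f.
    case=> D [E []]; rewrite -fA -gB => /imsetP[i _ ->] /imsetP[j _ ->] ->.
    by exists (i, j).
  apply: represents_imset (represents_fp_of _ _) _ _.
    move=> [i j] [i' j'] _ _; rewrite /h /= => eq_h.
    congr (_, _); [apply: f_inj|apply: g_inj]; apply/setP => x.
      by rewrite -(sum_setl _ (g j)) eq_h sum_setl.
    by rewrite -(sum_setr (f i)) eq_h sum_setr.
  move=> [i j] [i' j'] _ _; rewrite /h /subrel_set sum_subset /=.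
  by congr andb; rewrite -?[_ \subset _]/(subrel_set _ _) -?f_ord -?g_ord.
- exact: fmon_sum.
Qed.

(** A nonempty [A] has the two distinct down-sets [set0] and [A]. This matches the two counits. *)
Lemma forest_lattice_trivial P m :
  forest_lattice P m -> (tag P == 1%N) = (m == onecm utree).
Proof.
case=> T [r [A [fr [f [f_inj fA _]] <-]]].
have -> : tag P = #|downsets r A|.
  by rewrite -fA card_imset // cardsT card_ord.
have [->|A0] := eqVneq A set0; first by rewrite downsets0 cards1 fmon0 !eqxx.
transitivity false; last first.
  by apply/esym/eqP => /(fmon_eq1 fr) /eqP; apply/negP.
apply/negP => /cards1P[D dD].
have : A \in downsets r A by apply/downsetsP.
have : set0 \in downsets r A.
  by apply/downsetsP; rewrite sub0set; split=> // x y; rewrite inE.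
rewrite dD !inE => /eqP D0 /eqP AD.
by rewrite AD D0 eqxx in A0.
Qed.

(** * Intervals of a lattice of down-sets *)

Lemma downset_fp_down P (T : finType) (r : rel T) (A : {set T})
    (f : 'I_(tag P) -> {set T}) (a : 'I_(tag P)) :
  fp_embedding (downsets r A) (@subrel_set T) f ->
  represents (fp_down a) (downsets r (f a)) (@subrel_set T).
Proof.
case=> f_inj fA f_ord.
have /downsetsP[faA fad] : f a \in downsets r A by rewrite -fA imset_f.
have <- : f @: [set b | fp_rel b a] = downsets r (f a).
  apply/setP => D; apply/imsetP/downsetsP.
    case=> b; rewrite inE f_ord => ba ->; split=> // x y xa.
    have /downsetsP[fbA fbd] : f b \in downsets r A by rewrite -fA imset_f.
    by apply: fbd; apply: subsetP xa.
  (* A down-set of [f a] is also one of [A], because [f a] is itself closed downwards in [A]. *)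
  case=> Da Dd; have : D \in downsets r A.
    apply/downsetsP; split=> [|x y xA yD xy]; first exact: subset_trans faA.
    by apply: (Dd x y) => //; apply: (fad x y) => //; apply: subsetP yD.
  by rewrite -fA => /imsetP[b _ Db]; exists b; rewrite // inE f_ord -Db.
apply: represents_imset (represents_fp_of _ _) _ _ => i j _ _.
  exact: f_inj.
by rewrite -f_ord.
Qed.

Lemma downset_fp_up P (T : finType) (r : rel T) (A : {set T})
    (f : 'I_(tag P) -> {set T}) (a : 'I_(tag P)) :
  fp_embedding (downsets r A) (@subrel_set T) f ->
  represents (fp_up a) (downsets r (A :\: f a)) (@subrel_set T).
Proof.
case=> f_inj fA f_ord.
have fP b : f b \in downsets r A by rewrite -fA imset_f.
have /downsetsP[faA fad] := fP a.
have <- : (fun b => f b :\: f a) @: [set b | fp_rel a b] = downsets r (A :\: f a).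
  apply/setP => D; apply/imsetP/downsetsP.
    case=> b; rewrite inE f_ord => ab ->; have /downsetsP[fbA fbd] := fP b.
    split; first exact: setSD.
    move=> x y; rewrite !inE => /andP[xa xA] /andP[ya yb] xy.
    by rewrite xa (fbd x y).
  case; rewrite subsetD => /andP[DA dDa] Dd.
  (* The inverse of removing [f a] is to add it back. *)
  have : D :|: f a \in downsets r A.
    apply/downsetsP; rewrite subUset DA; split=> // x y xA.
    rewrite !inE => /orP[yD|ya] xy; last by rewrite (fad x y) ?orbT.
    case xa: (x \in f a); rewrite ?orbT // (Dd x y) //.
    by rewrite inE xa.
  rewrite -fA => /imsetP[b _ Db]; exists b.
    by rewrite inE f_ord -Db /subrel_set subsetUr.
  rewrite -Db; apply/setP => x; rewrite !inE; case xa: (x \in f a) => /=.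
    by move/disjoint_setI0: dDa => /setP/(_ x); rewrite !inE xa andbT.
  by rewrite orbF.
have fD i : fp_rel a i -> f i = f a :|: (f i :\: f a).
  by rewrite f_ord => /setIidPr ai; rewrite -{1}(setID (f i) (f a)) ai.
apply: represents_imset (represents_fp_of _ _) _ _ => i j; rewrite !inE => ai aj.
  by move=> eq_ij; apply: f_inj; rewrite (fD i ai) (fD j aj) eq_ij.
rewrite [tagged P _]f_ord; apply/idP/idP; last exact: setSD.
by move=> ij; rewrite (fD i ai) (fD j aj) /subrel_set setUS.
Qed.

(** * NAP intervals as lattices of down-sets *)

Section ParentFunctions.
Variable n : nat.
Implicit Types p x y : {ffun 'I_n -> option 'I_n}.

Definition anc p : rel 'I_n := connect (fun i j => p i == Some j).

Definition nonroots p : {set 'I_n} := [set i | p i != None].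

Lemma nonrootsP p i : reflect (exists j, p i = Some j) (i \in nonroots p).
Proof.
rewrite inE; case: (p i) => [j|]; first by left; exists j.
by right=> -[].
Qed.

Lemma nonrootsPn p i : i \notin nonroots p -> p i = None.
Proof. by rewrite inE negbK => /eqP. Qed.

Lemma iter_None p k : iter k (obind p) None = None.
Proof. by elim: k => //= k ->. Qed.

Lemma ancP p i j :
  reflect (exists k, iter k (obind p) (Some i) = Some j) (anc p i j).
Proof.
apply: (iffP connectP) => [[s]|[k]].
  elim: s i => [|i' s IHs] i /=; first by move=> _ ->; exists 0.
  case/andP=> /eqP pi /IHs{}IHs /IHs[k kP].
  by exists k.+1; rewrite iterSr /= pi.
elim: k i => [|k IHk] i; first by case=> ->; exists [::].
rewrite iterSr /=; case pi: (p i) => [i'|]; last by rewrite iter_None.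
by case/IHk => s ps ->; exists (i' :: s); rewrite //= pi eqxx.
Qed.

Lemma anc_parent p i j : p i = Some j -> anc p i j.
Proof. by move=> pij; apply/connect1/eqP. Qed.

Section Acyclic.
Variable p : {ffun 'I_n -> option 'I_n}.
Hypothesis acp : acyclic p.

Lemma acyclic_iter k i : iter k (obind p) (Some i) = Some i -> k = 0.
Proof.
move=> loop; apply/eqP; apply: contraT; rewrite -lt0n => k_gt0.
(* Running the loop [n] times takes at least [n] steps, by which point acyclicity has forced
   [None]. *)
have loops m : iter (m * k) (obind p) (Some i) = Some i.
  by elim: m => //= m IHm; rewrite mulSn iterD IHm.
have := loops n; rewrite -(subnK (leq_pmulr n k_gt0)) iterD.
by move/forallP/(_ i)/eqP: acp => ->; rewrite iter_None.
Qed.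

(** Ancestors of a vertex are the iterates of its parent map, hence ordered by their exponents;
    antisymmetry is the absence of loops. *)
Lemma anc_forest_order : forest_order (anc p).
Proof.
split; [exact: connect0| |exact: connect_trans|].
- move=> i j /andP[/ancP[k ki] /ancP[l lj]].
  have /acyclic_iter/eqP : iter (l + k) (obind p) (Some i) = Some i.
    by rewrite iterD ki.
  by rewrite addn_eq0 => /andP[_ /eqP k0]; move: ki; rewrite k0 => -[].
- move=> i j k /ancP[a ai] /ancP[b bi].
  case: (leqP a b) => [ab|/ltnW ba]; apply/orP; [left|right]; apply/ancP.
    by exists (b - a)%N; rewrite -ai -iterD subnK.
  by exists (a - b)%N; rewrite -bi -iterD subnK.
Qed.

End Acyclic.

(** Closed form of the NAP order. Edges are only added between roots, so a vertex that has been
    attached keeps its parent and receives no further child. *)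
Definition prunes x y := forall i, i \in nonroots x ->
  x i = y i /\ forall c, y c = Some i -> x c = Some i.

Lemma prunes_trans x y z : prunes x y -> prunes y z -> prunes x z.
Proof.
move=> xy yz i ix; have [xi ic] := xy i ix.
have iy : i \in nonroots y by move: ix; rewrite !inE xi.
have [yi jc] := yz i iy; split; first by rewrite xi.
by move=> c /jc/ic.
Qed.

Lemma nap_le_prunes x y : nap_le x y -> prunes x y.
Proof.
case/connectP=> s; elim: s x => [|z s IHs] x /=; first by move=> _ ->.
case/andP=> xz /IHs{}IHs /IHs; apply: prunes_trans.
case/existsP: xz => a /existsP[b /and4P[ab /eqP xa /eqP xb /eqP ->]] i ix.
have ia : (i == a) = false.
  by apply: contraTF ix => /eqP ->; rewrite inE xa.
rewrite !ffunE ia; split=> // c; rewrite ffunE; case: eqP => // _ [bi].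
by move: ix; rewrite inE -bi xb.
Qed.

(** The missing edges of [y] are added to [x] one at a time, deepest first. The acyclic forest [p]
    contains the edges of [y], and its ancestor order selects the next edge. *)
Lemma prunes_nap_le p x y : acyclic p ->
  (forall i j, y i = Some j -> p i = Some j) -> prunes x y -> nap_le x y.
Proof.
move=> acp yp; have [m] := ubnP #|nonroots y :\: nonroots x|.
elim: m => // m IHm in x *; rewrite ltnS => le_m xy.
have sub_xy : nonroots x \subset nonroots y.
  by apply/subsetP => i ix; have [xi _] := xy i ix; move: ix; rewrite !inE xi.
have [D0|D0] := eqVneq (nonroots y :\: nonroots x) set0.
  rewrite (_ : x = y) ?/nap_le ?connect0 //; apply/ffunP => i.
  have [ix|ix] := boolP (i \in nonroots x); first by have [] := xy i ix.
  rewrite (nonrootsPn ix) nonrootsPn //; apply: contra ix => iy.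
  by move: D0 => /setP/(_ i); rewrite in_set0 in_setD iy andbT => /negbFE.
have [ar aa at_ _] := anc_forest_order acp.
(* No vertex still to be attached lies strictly below [a]. Its parent [b] is a root of [x]:
   otherwise [x] would already contain all the [y]-children of [b], including [a]. *)
have [a] := poset_minimal ar aa at_ D0.
rewrite in_setD => /andP[ax ay] a_min.
have /nonrootsP[b yab] := ay; have pab := yp _ _ yab.
have xb : x b = None.
  apply/nonrootsPn/negP => /xy[_ /(_ a yab) xab].
  by case/negP: ax; apply/nonrootsP; exists b.
have ab : a != b.
  apply/eqP => eq_ab; have := @acyclic_iter p acp 1 a; rewrite /= pab eq_ab.
  by move/(_ erefl).
pose z : {ffun 'I_n -> option 'I_n} := [ffun i => if i == a then Some b else x i].
apply: (@connect_trans _ _ z).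
  apply/connect1/existsP; exists a; apply/existsP; exists b.
  by rewrite ab (nonrootsPn ax) xb !eqxx.
have nz : nonroots z = a |: nonroots x.
  by apply/setP => i; rewrite !inE ffunE; case: (eqVneq i a).
apply: IHm.
  apply: leq_trans le_m; apply: proper_card; apply/properP; split.
    by rewrite nz setDS // subsetUr.
  by exists a; rewrite in_setD ?ax ?ay // nz setU11.
move=> i; rewrite nz => /setU1P[->|ix].
  rewrite ffunE eqxx yab; split=> // c yca.
  have ca : c != a.
    by apply: contraNneq ab => ca; move: yca; rewrite ca yab => -[->].
  (* By minimality of [a], its children in [y] are already attached in [x], so adding the edge at
     [a] preserves [prunes]. *)
  have cx : c \in nonroots x.
    apply: contraR ca => cx; apply/eqP/a_min; last exact: anc_parent (yp _ _ yca).
    by rewrite in_setD cx; apply/nonrootsP; exists a.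
  by have [xc _] := xy c cx; rewrite ffunE (negPf ca) xc.
have [xi ic] := xy i ix.
have ia : i != a by apply: contraNneq ax => <-.
rewrite ffunE (negPf ia); split=> // c /ic xc; rewrite ffunE.
case: eqP => // ca; move: ax; rewrite -ca => /negP[].
by apply/nonrootsP; exists i.
Qed.

(** A forest below [p] is determined by its set of attached vertices, since their parents are copied
    from [p]. *)
Lemma nap_int_represents p : acyclic p ->
  represents (nap_int p) (downsets (anc p) (nonroots p)) (@subrel_set _).
Proof.
move=> acp.
have prunes_sub x : prunes x p -> forall i j, x i = Some j -> p i = Some j.
  move=> xp i j xij; rewrite -xij; symmetry.
  by have [|//] := xp i; apply/nonrootsP; exists j.
have inP x : reflect (prunes x p)
    (x \in [set x | nap_le (nap_zero n) x && nap_le x p]).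
  rewrite inE; apply: (iffP andP) => [[_ /nap_le_prunes //]|xp]; split.
    apply: (prunes_nap_le acp (prunes_sub x xp)) => i.
    by rewrite inE ffunE.
  exact: (prunes_nap_le acp).
have leP x y : prunes x p -> prunes y p ->
    nap_le x y = (nonroots x \subset nonroots y).
  move=> xp yp; apply/idP/subsetP => [/nap_le_prunes xy i ix|sxy].
    by have [xi _] := xy i ix; move: ix; rewrite !inE xi.
  apply: (prunes_nap_le acp (prunes_sub y yp)) => i ix.
  have [xi ci] := xp i ix; have [yi _] := yp i (sxy i ix).
  by rewrite xi yi; split=> // c /(prunes_sub y yp); apply: ci.
have <- : (fun x => nonroots x) @: [set x | nap_le (nap_zero n) x && nap_le x p]
    = downsets (anc p) (nonroots p).
  apply/setP => D; apply/imsetP/downsetsP.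
    case=> x /inP xp ->; split.
      by apply/subsetP => i /nonrootsP[j /(prunes_sub x xp) pij]; apply/nonrootsP; exists j.
    move=> c i _ ix /ancP[k]; elim: k c => [|k IHk] c; first by case=> ->.
    rewrite iterSr /=; case pc: (p c) => [c'|]; last by rewrite iter_None.
    by case/IHk/xp => _ /(_ c pc) xc; apply/nonrootsP; exists c'.
  (* Conversely, a down-set [D] comes from the forest keeping exactly the edges of [p] that leave
     [D] upwards from its vertices. *)
  case=> Dp Dd; pose x : {ffun 'I_n -> option 'I_n} :=
    [ffun i => if i \in D then p i else None].
  have xD : nonroots x = D.
    apply/setP => i; rewrite inE ffunE; case: ifP => // iD.
    by have := subsetP Dp i iD; rewrite inE.
  exists x => //; apply/inP => i; rewrite xD => iD; rewrite ffunE iD; split=> //.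
  move=> c pc; rewrite ffunE (Dd c i) //; first by apply/nonrootsP; exists i.
  exact: anc_parent.
apply: represents_imset (represents_fp_of _ _) _ _ => x y /inP xp /inP yp.
  move=> eq_xy; apply/ffunP => i.
  have [ix|ix] := boolP (i \in nonroots x).
    by have [-> _] := xp i ix; rewrite eq_xy in ix; have [-> _] := yp i ix.
  by rewrite (nonrootsPn ix); rewrite eq_xy in ix; rewrite (nonrootsPn ix).
by rewrite leP.
Qed.

Lemma forest_lattice_nap_int p : acyclic p ->
  forest_lattice (nap_int p) (fmon (anc p) (nonroots p)).
Proof.
move=> acp; exists 'I_n, (anc p), (nonroots p); split=> //.
  exact: anc_forest_order.
exact: nap_int_represents.
Qed.

End ParentFunctions.

Lemma nap_poset_forest_lattice Q : nap_poset Q -> exists m, forest_lattice Q m.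
Proof.
case=> ts [ts_tree isoQ].
suff [m mP] : exists m, forest_lattice
    (foldr fp_prod fp_pt [seq nap_int (tagged s) | s <- ts]) m.
  by exists m; apply: forest_lattice_iso isoQ mP.
elim: ts ts_tree {isoQ} => [|t ts IHts] /=.
  by exists (onecm utree); apply: forest_lattice_pt.
case/andP=> /andP[t_ac _] /IHts[m mP].
exists (mulcm (fmon (anc (tagged t)) (nonroots (tagged t))) m).
by apply: forest_lattice_prod => //; apply: forest_lattice_nap_int.
Qed.

(** * Labelled realizations of unlabelled trees *)

(** Vertex 0 is the only root and parents precede children, which makes acyclicity a matter of
    decreasing indices. *)
Record parent_list (l : seq (option nat)) : Prop := ParentList {
  pl_size : (0 < size l)%N;
  pl_root : nth None l 0 = None;
  pl_parent : forall i, (0 < i < size l)%N ->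
    exists2 j, nth None l i = Some j & (j < i)%N
}.

Lemma rawtree_ind (P : rawtree -> Prop) :
  (forall n, P (GenTree.Leaf n)) ->
  (forall n (ts : seq rawtree), {in ts, forall t, P t} -> P (GenTree.Node n ts)) ->
  forall t, P t.
Proof.
move=> PL PN; elim/GenTree.tree_ind => [n|n ts IHts]; first exact: PL.
apply: PN; elim: ts IHts => [|t ts IH] //= [Pt /IH Pts] u.
by rewrite inE => /orP[/eqP->//|/Pts].
Qed.

Lemma nth_attach off ls i : (0 < off)%N -> {in ls, forall l, parent_list l} ->
  (i < size (attach off ls))%N ->
  exists j, [/\ nth None (attach off ls) i = Some j, (j < off + i)%N &
                j = 0 \/ (off <= j)%N].
Proof.
elim: ls off i => //= l ls IHls off i off_gt0 ls_wf.
rewrite size_cat size_map nth_cat size_map.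
have wf_l : parent_list l by apply: ls_wf; rewrite inE eqxx.
case: (ltnP i (size l)) => [i_lt _|i_ge].
  rewrite (nth_map None) //; case: i i_lt => [|i] i_lt.
    by exists 0; rewrite (pl_root wf_l) addn0; split; last left.
  have [j -> j_lt] := pl_parent wf_l (i := i.+1) i_lt.
  by exists (j + off)%N; rewrite addnC ltn_add2l leq_addr; split; last right.
rewrite -{1}(subnKC i_ge) ltn_add2l => i_lt.
have [||j [-> j_lt j_off]] := IHls (off + size l)%N _ _ _ i_lt.
- by rewrite addn_gt0 off_gt0.
- by move=> l' l'ls; apply: ls_wf; rewrite inE l'ls orbT.
exists j; split=> //; first by rewrite -addnA subnKC in j_lt.
by case: j_off => [|/(leq_trans (leq_addr _ _))]; [left|right].
Qed.

Lemma parent_list_lab t : parent_list (lab t).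
Proof.
elim/rawtree_ind: t => [n|n ts IHts] /=; first by split=> //= -[|[]].
split=> //= -[|i] //=; rewrite ltnS => i_lt.
have [|j [-> j_lt _]] := nth_attach (ltn0Sn 0) _ i_lt; last by exists j.
by move=> _ /mapP[t tts ->]; apply: IHts.
Qed.

Section ParentList.
Variable l : seq (option nat).
Hypothesis wf_l : parent_list l.

Lemma lab_ffunE (i : 'I_(size l)) : omap val (lab_ffun l i) = nth None l i.
Proof.
rewrite ffunE; case: i => [[|i] i_lt] /=; first by rewrite (pl_root wf_l).
have [j -> j_lt] /= := pl_parent wf_l (i := i.+1) i_lt.
by rewrite insubT //= (ltn_trans j_lt).
Qed.

Lemma lab_ffun_None (i : 'I_(size l)) : (lab_ffun l i == None) = (val i == 0).
Proof.
have : isSome (lab_ffun l i) = isSome (nth None l i).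
  by rewrite -lab_ffunE; case: (lab_ffun l i).
case: (lab_ffun l i) => [j|] /=; case: i => [[|i] i_lt] //=.
  by rewrite (pl_root wf_l).
by have [j -> ] := pl_parent wf_l (i := i.+1) i_lt.
Qed.

Lemma lab_ffun_lt (i j : 'I_(size l)) : lab_ffun l i = Some j -> (j < i)%N.
Proof.
move=> pij; have := lab_ffunE i; rewrite pij /=.
case: i {pij} => [[|i] i_lt] /=; first by rewrite (pl_root wf_l).
by have [k -> k_lt [->]] := pl_parent wf_l (i := i.+1) i_lt.
Qed.

Lemma iter_lab_ffun k (i j : 'I_(size l)) :
  iter k (obind (lab_ffun l)) (Some i) = Some j -> (j + k <= i)%N.
Proof.
elim: k i => [|k IHk] i; first by case=> ->; rewrite addn0.
rewrite iterSr /=; case pi: (lab_ffun l i) => [i'|]; last by rewrite iter_None.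
by move/IHk => le_i'; rewrite addnS (leq_ltn_trans le_i') ?lab_ffun_lt.
Qed.

Lemma lab_ffun_acyclic : acyclic (lab_ffun l).
Proof.
apply/forallP => i; case E: (iter _ _ _) => [j|//].
have /= := @iter_lab_ffun (size l) i j E.
by move/(leq_trans (leq_addl _ _)); rewrite leqNgt ltn_ord.
Qed.

Lemma lab_ffun_is_rtree : is_rtree (lab_ffun l).
Proof.
rewrite /is_rtree lab_ffun_acyclic; apply/cards1P.
exists (Ordinal (pl_size wf_l)); apply/setP => i.
by rewrite !inE lab_ffun_None.
Qed.

End ParentList.

Definition children_mon (l : seq (option nat)) : {cmonom utree} :=
  fmon (anc (lab_ffun l)) (nonroots (lab_ffun l)).

(** The root is an ancestor of every vertex, so including it contributes exactly one [B^+]. *)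
Lemma fmon_lab_ffun l : parent_list l ->
  fmon (anc (lab_ffun l)) setT = ucm (Bplus_m (children_mon l)).
Proof.
move=> wf_l; have [ar aa _ _] := anc_forest_order (lab_ffun_acyclic wf_l).
pose r0 := Ordinal (pl_size wf_l).
have anc0 i : anc (lab_ffun l) i r0.
  case: i => i; elim/ltn_ind: i => i IHi i_lt.
  case pi: (lab_ffun l (Ordinal i_lt)) => [[j j_lt]|].
    by apply: connect_trans (IHi j _ j_lt); [apply: anc_parent | apply: lab_ffun_lt pi].
  move/eqP: pi; rewrite lab_ffun_None // => /eqP i0.
  by rewrite (_ : Ordinal i_lt = r0) //; apply: val_inj.
rewrite (fmon_top (x := r0)) ?inE //; last by move=> i _ ri; apply: aa; rewrite anc0.
congr (ucm (Bplus_m (fmon _ _))); apply/setP => i.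
by rewrite !inE andbT lab_ffun_None.
Qed.

(** Each list in [ls] becomes a block of [L] whose root hangs from vertex 0. The prefix [pre] is
    generalized so that the induction can absorb the first block into it. *)
Lemma fmon_attach (L pre : seq (option nat)) ls :
  parent_list L -> {in ls, forall l, parent_list l} -> (0 < size pre)%N ->
  L = pre ++ attach (size pre) ls ->
  fmon (anc (lab_ffun L)) [set i | (size pre <= val i)%N] =
  \big[@mulcm utree/onecm utree]_(l <- ls) ucm (Bplus_m (children_mon l)).
Proof.
move=> wf_L; elim: ls pre => [|l ls IHls] pre ls_wf pre_gt0 LE.
  rewrite big_nil (_ : [set _ | _] = set0) ?fmon0 //; apply/setP => i.
  have sL : size L = size pre by rewrite LE cats0.
  by rewrite !inE leqNgt -sL ltn_ord.
have wf_l : parent_list l by apply: ls_wf; rewrite inE eqxx.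
have {}ls_wf : {in ls, forall l, parent_list l}.
  by move=> l' l'ls; apply: ls_wf; rewrite inE l'ls orbT.
set o := size pre in pre_gt0 LE *.
set blk := [seq (if i is Some j then Some (j + o)%N else Some 0%N) | i <- l].
have {}LE : L = (pre ++ blk) ++ attach (size (pre ++ blk)) ls.
  by rewrite LE /= -catA size_cat size_map.
have sizeL : size L = (o + size l + size (attach (size (pre ++ blk)) ls))%N.
  by rewrite {1}LE !size_cat size_map.
have nthL k : nth None L k =
    nth None ((pre ++ blk) ++ attach (size (pre ++ blk)) ls) k by rewrite -LE.
have f_lt (i : 'I_(size l)) : (o + i < size L)%N.
  by rewrite sizeL -addnA ltn_add2l ltn_addr.
pose f i := Ordinal (f_lt i).
have f_inj : injective f by move=> i j [] /addnI/val_inj.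
pose r0 := Ordinal (pl_size wf_L).
have pr0 : lab_ffun L r0 = None by apply/eqP; rewrite lab_ffun_None.
(* The shift [f] commutes with taking parents, except that the root of the block now has the parent
   [r0]. *)
have pf i : lab_ffun L (f i) = if lab_ffun l i is Some j then Some (f j) else Some r0.
  have := lab_ffunE wf_L (f i); rewrite nthL nth_cat size_cat size_map ltn_add2l.
  rewrite ltn_ord nth_cat ltnNge leq_addr /= addKn (nth_map None) //.
  rewrite -(lab_ffunE wf_l).
  case: (lab_ffun L (f i)) => [j|]; case: (lab_ffun l i) => [k|] //= [jk];
    by congr Some; apply: val_inj; rewrite /= jk // addnC.
have f_anc i j : anc (lab_ffun L) (f i) (f j) = anc (lab_ffun l) i j.
  (* A path leaving the block goes to [r0] and stops; [r0] is outside the block since [o] is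
     positive. *)
  have it k i' : iter k (obind (lab_ffun L)) (Some (f i')) = Some (f j) <->
                 iter k (obind (lab_ffun l)) (Some i') = Some j.
    elim: k i' => [|k IHk] i'; first by split=> [[/addnI/val_inj->]|[->]].
    rewrite !iterSr /= pf; case: (lab_ffun l i') => [i2|]; first exact: IHk.
    rewrite iter_None; split=> //; case: k {IHk} => [[]/eqP|k].
      by rewrite eq_sym addn_eq0 => /andP[/eqP o0]; rewrite o0 in pre_gt0.
    by rewrite iterSr /= pr0 iter_None.
  by apply/ancP/ancP => -[k /it ?]; exists k.
set B := [set i : 'I_(size L) | (size (pre ++ blk) <= val i)%N].
(* Ancestors of a vertex in the later blocks stay in these blocks or reach the common root. *)
have B_anc x y : y \in B -> anc (lab_ffun L) y x -> x \in B \/ x = r0.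
  move=> yB /ancP[k]; elim: k y yB => [|k IHk] y yB; first by case=> <-; left.
  rewrite iterSr /=; case py: (lab_ffun L y) => [z|]; last by rewrite iter_None.
  have zB : z \in B \/ z = r0.
    have := lab_ffunE wf_L y; rewrite py nthL nth_cat.
    move: yB; rewrite inE ltnNge => y_ge; rewrite y_ge /=.
    have [|||j [-> _ j0] [zj]] := @nth_attach (size (pre ++ blk)) ls
        (y - size (pre ++ blk)).
    - by rewrite size_cat addn_gt0 pre_gt0.
    - exact: ls_wf.
    - by rewrite ltn_subLR // -size_cat -LE.
    by case: j0 zj => [->|j_ge] zj; [right; apply: val_inj | left; rewrite inE /= zj].
  case: zB => [/IHk//|->]; case: k {IHk} => [[<-]|k]; first by right.
  by rewrite iterSr /= pr0 iter_None.
have -> : [set i | (o <= val i)%N] = f @: setT :|: B.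
  apply/setP => i; rewrite !inE size_cat size_map; apply/idP/orP.
    case: (leqP (o + size l)%N i) => [|i_lt i_ge]; [by right | left].
    have i_lt' : (i - o < size l)%N by rewrite ltn_subLR.
    by apply/imsetP; exists (Ordinal i_lt') => //; apply: val_inj; rewrite /= subnKC.
  by case=> [/imsetP[j _ ->]|/(leq_trans (leq_addr _ _))//]; rewrite leq_addr.
have fB i : f i \notin B by rewrite inE size_cat size_map -ltnNge ltn_add2l.
rewrite fmonU.
- rewrite big_cons -(IHls (pre ++ blk)) //; last by rewrite size_cat ltn_addr.
  congr mulcm; rewrite (fmon_imset (r := anc (lab_ffun l))) ?fmon_lab_ffun //.
  by move=> i j _ _; apply: f_inj.
- rewrite -setI_eq0; apply/eqP/setP => i; rewrite in_setI in_set0.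
  by apply/negP => /andP[/imsetP[j _ ->]]; apply/negP.
(* By [B_anc], no vertex of this block is an ancestor of a later one; the other direction fails
   because ancestors never have larger indices. *)
move=> _ y /imsetP[i _ ->] yB; split; apply/negP; last first.
  case/(B_anc _ _ yB) => [|[]/eqP]; first exact/negP.
  by rewrite addn_eq0 => /andP[/eqP o0]; rewrite o0 in pre_gt0.
case/ancP=> k /(iter_lab_ffun wf_L)/(leq_trans (leq_addr _ _)) le_y.
move: yB; rewrite inE size_cat size_map => /leq_trans/(_ le_y).
by rewrite /= leq_add2l leqNgt ltn_ord.
Qed.

Lemma children_mon_Node n (ts : seq rawtree) :
  children_mon (lab (GenTree.Node n ts)) =
  \big[@mulcm utree/onecm utree]_(t <- ts) ucm (Bplus_m (children_mon (lab t))).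
Proof.
rewrite -(big_map lab xpredT (fun l => ucm (Bplus_m (children_mon l)))).
rewrite -(@fmon_attach (lab (GenTree.Node n ts)) [:: None]) //.
- congr fmon; apply/setP => i.
  by rewrite !inE lab_ffun_None ?lt0n //; apply: parent_list_lab.
- exact: parent_list_lab.
- by move=> _ /mapP[t _ ->]; apply: parent_list_lab.
Qed.

(** Labelling a canonical tree and reading it back loses nothing: its children are already sorted,
    so sorting them again changes nothing. *)
Lemma Bplus_children_mon (u : utree) : Bplus_m (children_mon (lab (val u))) = u.
Proof.
apply: val_inj; move: (valP u); move: (val u) => {u} t.
elim/rawtree_ind: t => // n ts IHts.
case/andP=> /andP[/eqP-> ts_sorted] /allP ts_canon.
rewrite children_mon_Node.
rewrite -(big_map (fun t => Bplus_m (children_mon (lab t))) xpredT (@ucm utree)).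
rewrite Bplus_m_prod /=; congr GenTree.Node.
rewrite -map_comp (_ : map _ ts = ts) ?sorted_sort //; first exact: tle_trans.
rewrite -[RHS]map_id; apply/eq_in_map => t tts /=.
by apply: IHts => //; apply: ts_canon.
Qed.

Lemma forest_lattice_tree_int (us : seq utree) :
  forest_lattice (tree_int (GenTree.Node 0 (map val us)))
    (\big[@mulcm utree/onecm utree]_(u <- us) ucm u).
Proof.
have := forest_lattice_nap_int
  (lab_ffun_acyclic (parent_list_lab (GenTree.Node 0 (map val us)))).
rewrite -/(children_mon _) children_mon_Node big_map.
by under eq_bigr do rewrite Bplus_children_mon.
Qed.

(** The one-factor product still contains the point [fp_pt]; its monomial is unchanged by this
    factor, so the two posets are isomorphic. *)
Lemma nap_poset_tree_int t : nap_poset (tree_int t).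
Proof.
exists [:: Tagged (fun n => {ffun 'I_n -> option 'I_n}) (lab_ffun (lab t))].
have wf_t := parent_list_lab t; rewrite /= lab_ffun_is_rtree //; split=> //.
have flt := forest_lattice_nap_int (lab_ffun_acyclic wf_t).
apply: (forest_lattice_inj flt); rewrite -[X in forest_lattice _ X]mulcm0.
exact: forest_lattice_prod flt forest_lattice_pt.
Qed.

Import GRing.Theory.
Local Open Scope ring_scope.

(** * Admissible cuts *)

Section PairMonomials.
Variables M N : conomType.
Implicit Types x y z : M * N.

Definition pair_mone : M * N := (mone, mone).
Definition pair_mmul x y : M * N := (mmul x.1 y.1, mmul x.2 y.2).

Lemma pair_mmulA : associative pair_mmul.
Proof. by move=> x y z; rewrite /pair_mmul /= !mulmA. Qed.

Lemma pair_mmul1m : left_id pair_mone pair_mmul.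
Proof. by move=> [x1 x2]; rewrite /pair_mmul /= !mul1m. Qed.

Lemma pair_mmulm1 : right_id pair_mone pair_mmul.
Proof. by move=> [x1 x2]; rewrite /pair_mmul /= !mulm1. Qed.

Lemma pair_unitm x y :
  pair_mmul x y = pair_mone -> x = pair_mone /\ y = pair_mone.
Proof.
by case: x y => [x1 x2] [y1 y2] [] /unitm[-> ->] /unitm[-> ->].
Qed.

Lemma pair_mmulC : commutative pair_mmul.
Proof. by move=> x y; rewrite /pair_mmul mulmC [mmul x.2 _]mulmC. Qed.

HB.instance Definition _ := Choice_isMonomialDef.Build (M * N)%type
  pair_mmulA pair_mmul1m pair_mmulm1 pair_unitm.
HB.instance Definition _ :=
  MonomialDef_isConomialDef.Build (M * N)%type pair_mmulC.

End PairMonomials.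

Section LinearExtension.
Variables (R : comNzRingType) (K : choiceType) (V : lmodType R) (h : K -> V).

(** The common form of [idBp], [Bp], [DeltaN], [DeltaR] and [tens], which thereby become linear maps
    determined on basis elements. *)
Definition lin_ext (g : {malg R[K]}) : V := \sum_(k <- msupp g) g@_k *: h k.

Lemma lin_extEw (d : {fset K}) g : (msupp g `<=` d)%fset ->
  lin_ext g = \sum_(k <- d) g@_k *: h k.
Proof.
move=> le_gd; rewrite [LHS](big_fset_incl _ le_gd) //= => k _ /mcoeff_outdom ->.
by rewrite scale0r.
Qed.

Lemma lin_ext_is_linear : linear lin_ext.
Proof.
move=> a x y; pose d := (msupp x `|` msupp y)%fset.
have le_d : (msupp (a *: x + y) `<=` d)%fset.
  apply: fsubset_trans (msuppD_le _ _) _.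
  by rewrite fsetSU ?msuppZ_le.
rewrite (lin_extEw le_d) (lin_extEw (fsubsetUl _ _ : (msupp x `<=` d)%fset)).
rewrite (lin_extEw (fsubsetUr _ _ : (msupp y `<=` d)%fset)).
rewrite scaler_sumr -big_split; apply: eq_bigr => k _ /=.
by rewrite mcoeffD mcoeffZ scalerDl scalerA.
Qed.

HB.instance Definition _ :=
  GRing.isLinear.Build R {malg R[K]} V *:%R lin_ext lin_ext_is_linear.

Lemma lin_extU k : lin_ext << k >> = h k.
Proof.
by rewrite (lin_extEw msuppU_le) big_seq_fset1 mcoeffUU scale1r.
Qed.

End LinearExtension.

Lemma eq_lin_ext (R : comNzRingType) (K : choiceType) (V : lmodType R)
    (h h' : K -> V) (g : {malg R[K]}) :
  {in msupp g, h =1 h'} -> lin_ext h g = lin_ext h' g.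
Proof.
by move=> eq_h; rewrite /lin_ext !big_seq; apply: eq_bigr => k /eq_h ->.
Qed.

Lemma lin_ext_comp (R : comNzRingType) (K L : choiceType) (V : lmodType R)
    (h : K -> {malg R[L]}) (h' : L -> V) (g : {malg R[K]}) :
  lin_ext h' (lin_ext h g) = lin_ext (fun k => lin_ext h' (h k)) g.
Proof.
by rewrite [in LHS]/(lin_ext h g) linear_sum; apply: eq_bigr => k _; rewrite linearZ.
Qed.

Lemma malgZU (R : comNzRingType) (K : choiceType) (c : R) (k : K) :
  c *: << k >> = << c *g k >> :> {malg R[K]}.
Proof. by apply/malgP => k'; rewrite mcoeffZ !mcoeffU mulr_natr. Qed.

Lemma malg_lin_ext (R : comNzRingType) (K : choiceType) (g : {malg R[K]}) :
  lin_ext (fun k => << k >>) g = g.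
Proof.
by rewrite [RHS]monalgE; apply: eq_bigr => k _; rewrite malgZU.
Qed.

Section HopfAlgebras.
Variable R : comNzRingType.

Lemma malgUM (M : monomType) (k k' : M) :
  << k >> * << k' >> = << mmul k k' >> :> {malg R[M]}.
Proof. by rewrite malgM_def fgmulUU mulr1. Qed.

Lemma tmulE (x y : TR R) : tmul x y = x * y.
Proof.
by apply: eq_bigr => p _; apply: eq_bigr => q _; rewrite malgZU.
Qed.

Lemma foldr_tmul (s : seq (TR R)) : foldr (@tmul R) (tone R) s = \prod_(x <- s) x.
Proof.
elim: s => [|x s IHs]; first by rewrite big_nil.
by rewrite /= IHs tmulE big_cons.
Qed.

Lemma idBpE (x : TR R) :
  idBp x = lin_ext (fun p => << (p.1, ucm (Bplus_m p.2)) >>) x.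
Proof. by []. Qed.

Lemma DeltaFE m : DeltaF R m = \prod_(u <- mlist m) DeltaT R (val u).
Proof. by rewrite /DeltaF foldr_tmul big_map. Qed.

Lemma DeltaF1 : DeltaF R (onecm utree) = 1.
Proof. by rewrite DeltaFE mlist1 big_nil. Qed.

Lemma DeltaFM m m' : DeltaF R (mulcm m m') = DeltaF R m * DeltaF R m'.
Proof. by rewrite !DeltaFE (perm_big _ (mlistM _ _)) big_cat. Qed.

(** The Connes-Kreimer recursion on monomials: sorting the children and re-embedding them in [utree]
    leave their multiset unchanged. *)
Lemma DeltaF_Bplus m :
  DeltaF R (ucm (Bplus_m m)) =
  << (ucm (Bplus_m m), onecm utree) >> + idBp (DeltaF R m).
Proof.
rewrite DeltaFE mlistU big_seq1 /= foldr_tmul big_map.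
have sort_m : perm_eq (sort tle [seq val u | u <- mlist m]) [seq val u | u <- mlist m].
  by rewrite perm_sort.
have -> : Bnode [seq insubd u1 t | t <- sort tle [seq val u | u <- mlist m]] =
    Bplus_m m.
  apply: Bnode_perm; apply: perm_trans (perm_map _ sort_m) _; rewrite -map_comp.
  by rewrite (eq_map (g := id)) ?map_id // => u /=; rewrite valKd.
by rewrite (perm_big _ sort_m) big_map -DeltaFE.
Qed.

(** * The sum over admissible cuts satisfies the coproduct recursion *)

Section Cuts.
Variables (T : finType) (r : rel T).
Hypothesis fo : forest_order r.
Implicit Types A B C : {set T}.

(** A down-set [D] is the pruned part of an admissible cut; its complement is the part retaining the
    uncut roots. *)
Definition cuts A : TR R :=
  \sum_(D in downsets r A) << (fmon r D, fmon r (A :\: D)) >>.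

Lemma cuts0 : cuts set0 = 1.
Proof. by rewrite /cuts downsets0 big_set1 setD0 !fmon0. Qed.

(** Cuts of incomparable parts are chosen independently, through the bijection of [D] with its
    traces on [A] and [B]. *)
Lemma cutsU A B : [disjoint A & B] -> incomparable r A B ->
  cuts (A :|: B) = cuts A * cuts B.
Proof.
move=> dAB iAB; rewrite /cuts big_distrlr /= pair_big /=.
have AIB x : x \in A -> x \in B -> false.
  by move=> xA xB; move/disjoint_setI0: dAB => /setP/(_ x); rewrite !inE xA xB.
rewrite (reindex_onto (fun DE => DE.1 :|: DE.2) (fun D => (D :&: A, D :&: B))) /=; last first.
  by move=> D /downsetsP[DAB _]; rewrite -setIUr; apply/setIidPl.
apply: eq_big => [[D E]|[D E]] /=.
  apply/andP/andP.
    case=> /downsetsP[DEAB DEd] /eqP[DA EB].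
    have sDA : D \subset A by rewrite -DA subsetIr.
    have sEB : E \subset B by rewrite -EB subsetIr.
    split; apply/downsetsP; split=> // x y xAB yDE xy.
      have := DEd x y; rewrite !inE xAB yDE => /(_ isT isT xy)/orP[//|xE].
      by case: (AIB x xAB (subsetP sEB x xE)).
    have := DEd x y; rewrite !inE xAB yDE !orbT => /(_ isT isT xy)/orP[xD|//].
    by case: (AIB x (subsetP sDA x xD) xAB).
  case=> /downsetsP[DA Dd] /downsetsP[EB Ed]; split.
    apply/downsetsP; split; first exact: setUSS.
    move=> x y; rewrite !inE => /orP[xA|xB] /orP[yD|yE] xy.
    - by rewrite (Dd x y).
    - by have [/negP] := iAB x y xA (subsetP EB y yE).
    - by have [_ /negP] := iAB y x (subsetP DA y yD) xB.
    - by rewrite (Ed x y) ?orbT.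
  apply/eqP; congr (_, _); apply/setP => x; rewrite !inE.
    case xA: (x \in A); rewrite ?andbT ?andbF.
      case xE: (x \in E); rewrite ?orbF //.
      by case: (AIB x xA (subsetP EB x xE)).
    by apply/esym/negP => /(subsetP DA); rewrite xA.
  case xB: (x \in B); rewrite ?andbT ?andbF.
    case xD: (x \in D); rewrite //=.
    by case: (AIB x (subsetP DA x xD) xB).
  by apply/esym/negP => /(subsetP EB); rewrite xB.
case/andP=> /downsetsP[DEAB DEd] /eqP[DA EB].
have sDA : D \subset A by rewrite -DA subsetIr.
have sEB : E \subset B by rewrite -EB subsetIr.
have -> : (A :|: B) :\: (D :|: E) = (A :\: D) :|: (B :\: E).
  apply/setP => x; rewrite !inE.
  case xA: (x \in A); case xB: (x \in B); rewrite ?andbT ?andbF ?orbF //=.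
  - by case: (AIB x xA xB).
  - case xE: (x \in E); rewrite ?orbF // orbT.
    by move/(subsetP sEB): xE; rewrite xB.
  - case xD: (x \in D) => //.
    by move/(subsetP sDA): xD; rewrite xA.
have iDE : incomparable r D E.
  by move=> x y xD yE; apply: iAB; [apply: subsetP xD | apply: subsetP yE].
have iDE' : incomparable r (A :\: D) (B :\: E).
  by move=> x y /setDP[xA _] /setDP[yB _]; apply: iAB.
rewrite malgUM (fmonU _ iDE) ?(fmonU _ iDE') //.
  by apply: disjointW dAB; apply: subsetDl.
by apply: disjointW dAB.
Qed.

Lemma downsets_top C x : x \notin C -> {in C, forall y, r y x} ->
  downsets r (x |: C) = (x |: C) |: downsets r C.
Proof.
move=> xC Cx; have [rr ra rt rc] := fo; apply/setP => D; rewrite in_setU1.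
apply/downsetsP/predU1P => [[DxC Dd]|[->|/downsetsP[DC Dd]]]; last 2 first.
- by [].
- split; first exact: subset_trans DC (subsetUr _ _).
  move=> y z /setU1P[->|yC] zD yz; last exact: Dd yz.
  have zC := subsetP DC z zD.
  have zx : z = x by apply: ra; rewrite yz Cx.
  by move: zC; rewrite zx (negPf xC).
have [xD|xD] := boolP (x \in D); [left | right].
  apply/eqP; rewrite eqEsubset DxC.
  apply/subsetP => y yxC; apply: Dd xD _ => //.
  by case/setU1P: yxC => [->|/Cx].
apply/downsetsP; split=> [|y z yC zD yz]; last by apply: (Dd y z) => //; rewrite inE yC orbT.
by apply/subsetP => y yD; have /setU1P[yx|//] := subsetP DxC y yD;
  rewrite -yx yD in xD.
Qed.

(** A down-set containing the top [x] is everything and gives the first term. Any other lies in [C],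
    and [x] then tops the complement, which is the [B^+] in the second factor. *)
Lemma cuts_top C x : x \notin C -> {in C, forall y, r y x} ->
  cuts (x |: C) = << (ucm (Bplus_m (fmon r C)), onecm utree) >> + idBp (cuts C).
Proof.
move=> xC Cx; have [rr ra rt rc] := fo.
have fmon_x (D : {set T}) : D \subset C -> fmon r (x |: D) = ucm (Bplus_m (fmon r D)).
  move=> DC; have xD : x \notin D by apply: contra xC; apply: subsetP.
  rewrite (@fmon_top _ _ _ x) ?setU11 ?setU1K //.
    by move=> y /setU1P[->//|/(subsetP DC)/Cx].
  move=> y /setU1P[->//|/(subsetP DC)/Cx yx xy].
  by apply: ra; rewrite xy yx.
have xCd : x |: C \notin downsets r C.
  by apply/negP => /downsetsP[/subsetP/(_ x)]; rewrite setU11 (negPf xC) => /(_ isT).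
rewrite /cuts downsets_top // [LHS](big_setU1 _ xCd) /= setDv fmon0 fmon_x //.
rewrite idBpE linear_sum /=.
have F D : D \in downsets r C ->
    fmon r ((x |: C) :\: D) = ucm (Bplus_m (fmon r (C :\: D))).
  move=> /downsetsP[DC _]; rewrite -fmon_x ?subsetDl //; congr (fmon r _).
  apply/setP => y; rewrite !inE; case: (eqVneq y x) => [->|] //=.
  by rewrite andbT (contra (subsetP DC x)).
by congr (_ + _); apply: eq_bigr => D DC; rewrite F // lin_extU.
Qed.

Lemma cuts_DeltaF A : cuts A = DeltaF R (fmon r A).
Proof.
move: A; apply: (forest_order_ind fo) => [|A x xt IHC IHB].
  by rewrite cuts0 fmon0 DeltaF1.
have [AE xC Cx dA iA] := tops_split fo xt.
rewrite {1}AE cutsU // cuts_top // IHC IHB (fmon_split fo xt).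
by rewrite DeltaFM DeltaF_Bplus.
Qed.

End Cuts.

Lemma forest_lattice_coproduct P m : forest_lattice P m ->
  \sum_(a : 'I_(tag P))
     << (birkhoff_mon (fp_down a), birkhoff_mon (fp_up a)) >> = DeltaF R m.
Proof.
case=> T [r [A [fr [f fP] <-]]]; rewrite -cuts_DeltaF //.
have [f_inj fA _] := fP.
rewrite /cuts -fA big_imset /=; last by move=> a b _ _; apply: f_inj.
apply: eq_big => [a|a _]; first by rewrite inE.
rewrite (@forest_lattice_birkhoff (fp_down a) (fmon r (f a))); last first.
  by exists T, r, (f a); split=> //; apply: downset_fp_down fP.
rewrite (@forest_lattice_birkhoff (fp_up a) (fmon r (A :\: f a))) //.
by exists T, r, (A :\: f a); split=> //; apply: downset_fp_up fP.
Qed.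
End HopfAlgebras.

(** * The isomorphism and its uniqueness *)

Definition canonical_nap (P : fposet) : Prop :=
  exists Q, nap_poset Q /\ P = fp_canon Q.

Lemma birkhoff_mon_iso P Q : fp_iso P Q -> birkhoff_mon P = birkhoff_mon Q.
Proof. by move/fp_isoP/birkhoff_mon_represents. Qed.

Lemma birkhoff_mon_canon P : birkhoff_mon (fp_canon P) = birkhoff_mon P.
Proof. exact/esym/birkhoff_mon_iso/fp_canon_iso. Qed.

Lemma canonical_nap_lattice P :
  canonical_nap P -> forest_lattice P (birkhoff_mon P).
Proof.
case=> Q [/nap_poset_forest_lattice[m Qm] ->].
have cQm := forest_lattice_iso (fp_iso_sym (fp_canon_iso Q)) Qm.
by rewrite (forest_lattice_birkhoff cQm).
Qed.

Lemma forest_lattice_canon_eq P Q m :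
  forest_lattice P m -> forest_lattice Q m -> fp_canon P = fp_canon Q.
Proof. by move=> Pm /(forest_lattice_inj Pm)/fp_canon_eq. Qed.

Lemma canonical_napK P : canonical_nap P -> fp_canon P = P.
Proof. by case=> Q [_ ->]; rewrite -(fp_canon_eq (fp_canon_iso Q)). Qed.

Lemma canonical_nap_inj P Q : canonical_nap P -> canonical_nap Q ->
  birkhoff_mon P = birkhoff_mon Q -> P = Q.
Proof.
move=> cP cQ eqPQ; rewrite -(canonical_napK cP) -(canonical_napK cQ).
apply: forest_lattice_canon_eq (canonical_nap_lattice cQ).
by rewrite -eqPQ; apply: canonical_nap_lattice.
Qed.

Definition forest_int (us : seq utree) : fposet :=
  tree_int (GenTree.Node 0 [seq val u | u <- us]).

(** Both forms are needed: the literal one for [tree_int], and [Bnode] for [Bp]. *)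
Lemma utree_Node (t : utree) :
  exists us : seq utree, val t = GenTree.Node 0 [seq val u | u <- us] /\ t = Bnode us.
Proof.
case: t => -[//|n ts] t_canon; have := t_canon.
case/andP=> /andP[/eqP n0 ts_sorted] /allP ts_canon; subst n.
have tsE : [seq val u | u <- map (insubd u1) ts] = ts.
  rewrite -map_comp -[RHS]map_id; apply/eq_in_map => t tts /=.
  by rewrite insubdK //; apply: ts_canon.
exists (map (insubd u1) ts); rewrite tsE; split=> //.
by apply: val_inj => /=; rewrite tsE sorted_sort //; apply: tle_trans.
Qed.

Section Isomorphism.
Variable R : comNzRingType.

(** [birkhoff_mon] is total, so the map is defined on the free module on all finite posets; its Hopf
    properties are established on [in_HNAP]. *)
Definition nap_iso : MN R -> HR R := lin_ext (fun P => << birkhoff_mon P >>).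

Lemma nap_isoU P : nap_iso << P >> = << birkhoff_mon P >>.
Proof. exact: lin_extU. Qed.

Lemma nap_iso_FN P : nap_iso (FN R P) = << birkhoff_mon P >>.
Proof. by rewrite nap_isoU birkhoff_mon_canon. Qed.

Lemma nap_isoE (x : MN R) :
  nap_iso x = \sum_(P <- msupp x) x@_P *: << birkhoff_mon P >>.
Proof. by []. Qed.

Lemma nap_iso_linear (a : R) (x y : MN R) :
  nap_iso (a *: x + y) = a *: nap_iso x + nap_iso y.
Proof. exact: linearP. Qed.

HB.instance Definition _ := GRing.isLinear.Build R {malg R[fposet]}
  {malg R[{cmonom utree}]} *:%R nap_iso nap_iso_linear.

Lemma prod_tree (us : seq utree) : \prod_(u <- us) tree R u =
  << \big[@mulcm utree/onecm utree]_(u <- us) ucm u >>.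
Proof.
elim: us => [|u us IHus]; first by rewrite !big_nil.
rewrite big_cons IHus (@big_cons _ (onecm utree) (@mulcm utree)).
exact: malgUM.
Qed.

Lemma nap_iso_forest us :
  nap_iso (FN R (forest_int us)) = \prod_(u <- us) tree R u.
Proof.
rewrite nap_iso_FN prod_tree.
by rewrite (forest_lattice_birkhoff (forest_lattice_tree_int us)).
Qed.

Lemma Bp_prod_tree us : Bp (\prod_(u <- us) tree R u) = tree R (Bnode us).
Proof.
rewrite prod_tree -Bplus_m_prod.
exact: (lin_extU (fun m => tree R (Bplus_m m))).
Qed.

Lemma nap_iso_LN t : nap_iso (LN R t) = tree R t.
Proof. by rewrite -[LN R t]/(FN R (forest_int [:: t])) nap_iso_forest big_seq1. Qed.

Lemma in_HNAP_lin (a : R) (x y : MN R) :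
  in_HNAP x -> in_HNAP y -> in_HNAP (a *: x + y).
Proof.
move=> xH yH P /(fsubsetP (msuppD_le _ _)); rewrite in_fsetU => /orP[|/yH//].
by move/(fsubsetP (msuppZ_le _ _))/xH.
Qed.

Lemma in_HNAP0 : in_HNAP (0 : MN R).
Proof. by move=> P; rewrite msupp0. Qed.

Lemma in_HNAP_FN Q : nap_poset Q -> in_HNAP (FN R Q).
Proof. by move=> QN P; rewrite msuppU oner_eq0 in_fset1 => /eqP ->; exists Q. Qed.

(** Distinct basis elements of [H_NAP] have distinct monomials, so no other term contributes to this
    coefficient. *)
Lemma nap_iso_coeff (x : MN R) P : in_HNAP x -> canonical_nap P ->
  (nap_iso x)@_(birkhoff_mon P) = x@_P.
Proof.
move=> xH cP; rewrite nap_isoE raddf_sum /=.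
transitivity (\sum_(Q <- msupp x) if Q == P then x@_P else 0).
  rewrite !big_seq; apply: eq_bigr => Q /xH cQ; rewrite mcoeffZ mcoeffU1.
  have [->|QP] := eqVneq Q P; first by rewrite eqxx mulr1.
  case: eqP => [/(canonical_nap_inj cQ cP) eqQP|]; last by rewrite mulr0.
  by rewrite eqQP eqxx in QP.
have [Px|Px] := boolP (P \in msupp x).
  rewrite (big_fsetD1 P) //= eqxx big1_fset ?addr0 // => Q.
  by rewrite in_fsetD1 => /andP[/negPf->].
rewrite mcoeff_outdom // big_seq big1 // => Q Qx.
by case: eqP => // QP; rewrite -QP Qx in Px.
Qed.

Lemma nap_iso_inj (x y : MN R) :
  in_HNAP x -> in_HNAP y -> nap_iso x = nap_iso y -> x = y.
Proof.
move=> xH yH eq_xy; apply/malgP => P.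
have coeffP : canonical_nap P -> x@_P = y@_P.
  by move=> cP; rewrite -(nap_iso_coeff xH cP) eq_xy nap_iso_coeff.
have [/xH/coeffP//|Px] := boolP (P \in msupp x).
have [/yH/coeffP//|Py] := boolP (P \in msupp y).
by rewrite !mcoeff_outdom.
Qed.

Lemma nap_iso_surj (z : HR R) : exists2 x, in_HNAP x & nap_iso x = z.
Proof.
(* The preimage of a forest is the class of the interval of the tree obtained by grafting it on a
   new root. *)
exists (lin_ext (fun m => FN R (forest_int (mlist m))) z).
  rewrite /lin_ext; elim/big_rec: _ => [|m x _ xH]; first exact: in_HNAP0.
  by apply: in_HNAP_lin => //; apply/in_HNAP_FN/nap_poset_tree_int.
rewrite -[RHS]malg_lin_ext [X in nap_iso X]/lin_ext linear_sum.
apply: eq_bigr => m _; rewrite linearZ /= nap_iso_forest.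
by rewrite prod_tree prod_mlist.
Qed.

Lemma mulN_FN P Q : mulN (FN R P) (FN R Q) = FN R (fp_prod (fp_canon P) (fp_canon Q)).
Proof.
rewrite /mulN !msuppU oner_eq0 !big_seq_fset1 !mcoeffUU mulr1.
by rewrite scale1r.
Qed.

Lemma nap_isoM (x y : MN R) : in_HNAP x -> in_HNAP y ->
  nap_iso (mulN x y) = nap_iso x * nap_iso y.
Proof.
move=> xH yH; rewrite [nap_iso x]nap_isoE [nap_iso y]nap_isoE mulr_suml.
rewrite /mulN [LHS]linear_sum !big_seq; apply: eq_bigr => P /xH cP.
rewrite mulr_sumr [LHS]linear_sum !big_seq; apply: eq_bigr => Q /yH cQ.
rewrite [LHS]linearZ /= nap_iso_FN.
rewrite -scalerAl -scalerAr scalerA malgUM.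
have := forest_lattice_prod (canonical_nap_lattice cP) (canonical_nap_lattice cQ).
by move/forest_lattice_birkhoff->.
Qed.

Lemma nap_iso_eps (x : MN R) : in_HNAP x -> epsR (nap_iso x) = epsN x.
Proof.
move=> xH; rewrite /epsR nap_isoE raddf_sum /epsN !big_seq.
apply: eq_bigr => P /xH cP /=; rewrite mcoeffZ mcoeffU1.
rewrite (forest_lattice_trivial (canonical_nap_lattice cP)).
by case: eqP; rewrite ?mulr1 ?mulr0.
Qed.

Lemma tpureU (m m' : {cmonom utree}) :
  tpure << m >> << m' >> = << (m, m') >> :> TR R.
Proof.
(* Abstracting the two basis elements keeps unification from comparing them by
   unfolding. *)
have gen (x y : HR R) : msupp x = [fset m]%fset -> msupp y = [fset m']%fset ->
    x@_m = 1 -> y@_m' = 1 -> tpure x y = << (m, m') >>.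
  by move=> xm ym x1 y1; rewrite /tpure xm ym !big_seq_fset1 x1 y1 mulr1 scale1r.
by apply: gen; rewrite ?msuppU ?oner_eq0 ?mcoeffUU.
Qed.

Lemma nap_iso_Delta (x : MN R) : in_HNAP x ->
  tens nap_iso (DeltaN x) = DeltaR (nap_iso x).
Proof.
move=> xH.
pose tb (p : fposet * fposet) := tpure (nap_iso << p.1 >>) (nap_iso << p.2 >>).
transitivity (lin_ext tb (lin_ext (@DeltaN_b R) x)); first by [].
transitivity (lin_ext (@DeltaF R) (nap_iso x)); last by [].
rewrite !lin_ext_comp; apply: eq_lin_ext => P /xH cP.
rewrite [RHS]lin_extU -(forest_lattice_coproduct R (canonical_nap_lattice cP)).
rewrite /DeltaN_b linear_sum; apply: eq_bigr => a _.
by rewrite [LHS]lin_extU /tb !nap_isoU !birkhoff_mon_canon tpureU.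
Qed.

Lemma nap_iso_hopf : hopf_iso_NAP_R nap_iso.
Proof.
split.
- exact: nap_iso_linear.
- exact: nap_iso_inj.
- exact: nap_iso_surj.
- split; last exact: nap_isoM.
  by rewrite nap_iso_FN (forest_lattice_birkhoff forest_lattice_pt).
- by move=> x xH; split; [apply: nap_iso_eps | apply: nap_iso_Delta].
Qed.

(** Both posets are lattices of the same forest. This writes every basis element as a product of
    values of [L_NAP], the only values that the cocycle condition controls. *)
Lemma FN_forest_cons u us :
  FN R (forest_int (u :: us)) = mulN (LN R u) (FN R (forest_int us)).
Proof.
rewrite mulN_FN /FN; congr << _ >>.
apply: forest_lattice_canon_eq (forest_lattice_tree_int _) _.
rewrite big_cons; apply: forest_lattice_prod.
  apply: forest_lattice_iso (fp_iso_sym (fp_canon_iso _)) _.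
  by have := forest_lattice_tree_int [:: u]; rewrite big_seq1.
apply: forest_lattice_iso (fp_iso_sym (fp_canon_iso _)) _.
exact: forest_lattice_tree_int.
Qed.

Lemma FN_forest_nil : FN R (forest_int [::]) = oneN R.
Proof.
rewrite /oneN /FN (@forest_lattice_canon_eq _ fp_pt (onecm utree)) //.
  by have := forest_lattice_tree_int [::]; rewrite big_nil.
exact: forest_lattice_pt.
Qed.

Section Uniqueness.
Variable psi : MN R -> HR R.
Hypothesis psi_hopf : hopf_iso_NAP_R psi.
Hypothesis psi_cocycle :
  forall t : utree, psi (LN R t) = Bp (psi (FN R (tree_int (val t)))).

Lemma psi_forest us : psi (FN R (forest_int us)) = \prod_(u <- us) psi (LN R u).
Proof.
case: psi_hopf => _ _ _ [psi1 psiM] _.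
elim: us => [|u us IHus]; first by rewrite FN_forest_nil big_nil psi1.
rewrite FN_forest_cons psiM ?big_cons ?IHus //;
  exact/in_HNAP_FN/nap_poset_tree_int.
Qed.

Lemma psi_LN u : psi (LN R u) = tree R u.
Proof.
(* The induction runs over raw trees, the recursive type underlying [utree]. *)
suff: forall (t : rawtree) (v : utree), val v = t -> psi (LN R v) = tree R v.
  by apply.
elim/rawtree_ind => [n|n ts IHts] v vE; first by have := valP v; rewrite /= vE.
have [us [vE' vB]] := utree_Node v.
rewrite psi_cocycle vE' psi_forest [in RHS]vB -Bp_prod_tree.
rewrite (eq_big_seq (tree R)) // => w wus; apply: (IHts (val w)) => //.
by move: vE; rewrite vE' => -[_ <-]; apply: map_f.
Qed.

Lemma psi_unique x : in_HNAP x -> psi x = nap_iso x.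
Proof.
case: psi_hopf => psi_lin _ _ _ _ xH.
have psi0 : psi 0 = 0.
  (* The scalar [-1] turns the linearity law at zero into [psi 0 = - psi 0 + psi 0]. *)
  by have := psi_lin (-1) 0 0; rewrite scaler0 addr0 scaleN1r addNr.
have -> : psi x = \sum_(P <- msupp x) x@_P *: psi << P >>.
  rewrite {1}[x]monalgE; elim: (enum_fset (msupp x)) => [|P s IHs].
    by rewrite !big_nil.
  by rewrite !big_cons -malgZU psi_lin IHs.
have psiU P : canonical_nap P -> psi << P >> = << birkhoff_mon P >>.
  (* Every basis element is the class of a single tree interval, namely that of the forest named by
     its Birkhoff monomial. *)
  move=> cP; have -> : << P >> = FN R (forest_int (mlist (birkhoff_mon P))).
    rewrite -{1}(canonical_napK cP) /FN.
    rewrite (forest_lattice_canon_eq (canonical_nap_lattice cP)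
      (Q := forest_int (mlist (birkhoff_mon P)))) //.
    by rewrite -{2}[birkhoff_mon P]prod_mlist; apply: forest_lattice_tree_int.
  rewrite psi_forest (eq_bigr (tree R)) => [|u _]; last exact: psi_LN.
  by rewrite prod_tree prod_mlist.
by rewrite nap_isoE; apply: eq_big_seq => P /xH cP /=; rewrite psiU.
Qed.

End Uniqueness.
End Isomorphism.

Theorem theorem6p11 (R : fieldType) :
  exists phi : MN R -> HR R,
    [/\ hopf_iso_NAP_R phi,
        (forall ts : seq utree,
            phi (FN R (tree_int (GenTree.Node 0 [seq val t | t <- ts])))
            = \prod_(t <- ts) tree R t),
        (forall t : utree,
            phi (LN R t) = Bp (phi (FN R (tree_int (val t))))) &
        (forall psi : MN R -> HR R,
            hopf_iso_NAP_R psi ->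
            (forall t : utree,
                psi (LN R t) = Bp (psi (FN R (tree_int (val t))))) ->
            forall x : MN R, in_HNAP x -> psi x = phi x)].
Proof.
exists (@nap_iso R); split.
- exact: nap_iso_hopf.
- exact: nap_iso_forest.
(* With [t] written as [B^+] of its children, both sides evaluate to the tree [t]. *)
- move=> t; have [us [tE tB]] := utree_Node t.
  by rewrite nap_iso_LN tE nap_iso_forest Bp_prod_tree -tB.
- by move=> psi psi_hopf psi_cocycle x; apply: psi_unique.
Qed.
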